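(* Every $(\gamma,\lambda)\in\mathcal{N}''$ is algebraic, i.e., both $\gamma$ and $\lambda$ are algebraic numbers.
   Context: $\mathcal{B}=\{1+\sum_{n=1}^{\infty}a_nx^n : a_n\in\{-1,0,1\}\}$, a set of power series converging on $(-1,1)$. $\mathcal{N}=\{(\gamma,\lambda)\in(-1,1)^2:\text{ there exists } f\in\mathcal{B} \text{ with } f(\gamma)=f(\lambda)=0\}$ and $\mathrm{Diag}=\{(\lambda,\lambda):\lambda\in(-1,1)\}$. The set of outlier points is $\mathcal{N}''=\{(\gamma,\lambda)\in\mathcal{N}\setminus\mathrm{Diag} : (\gamma,\lambda)\notin\overline{\mathcal{N}^{\mathrm{o}}}\}$, where $\mathcal{N}^{\mathrm{o}}$ is the interior of $\mathcal{N}$ in $\mathbb{R}^2$ and the bar denotes closure in $\mathbb{R}^2$. *)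

(* Defs.v *)
From mathcomp Require Import all_boot all_order all_algebra.
From mathcomp Require Import all_classical all_reals all_analysis.

Set Implicit Arguments.
Unset Strict Implicit.
Unset Printing Implicit Defensive.

Import Order.TTheory GRing.Theory Num.Theory.
Import numFieldNormedType.Exports.

Local Open Scope classical_set_scope.
Local Open Scope ring_scope.

(* A power series is represented by its sequence of coefficients. *)
Definition powser_class (R : realType) : set (R^nat) :=
  [set a | a 0%N = 1 /\ forall n, (0 < n)%N -> a n \in [:: -1; 0; 1]].

(* The limit is a junk value if the series diverges; by is_cvg_powser_class,
   it converges whenever a is in powser_class and -1 < x < 1. *)
Definition powser_eval (R : realType) (a : R^nat) (x : R) : R :=
  limn (pseries a x).

Lemma is_cvg_powser_class (R : realType) (a : R^nat) (x : R) :
  powser_class a -> -1 < x < 1 -> cvgn (pseries a x).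
Proof.
move=> [a0 ap]; rewrite -ltr_norml => x1; apply: normed_cvg.
apply: (@series_le_cvg _ _ (geometric 1 `|x|)) => [n|n|n|] /=.
- exact: normr_ge0.
- by rewrite mul1r (@exprn_ge0 R).
- rewrite normrM normrX; apply: ler_wpM2r; first by rewrite (@exprn_ge0 R).
  case: n => [|n]; first by rewrite a0 normr1.
  by have := ap n.+1 isT; rewrite !inE => /or3P[] /eqP ->;
    rewrite ?normrN ?normr1 ?normr0.
- by apply: is_cvg_geometric_series; rewrite normr_id.
Qed.

Definition common_zeros (R : realType) : set (R * R) :=
  [set p | [/\ -1 < p.1 < 1, -1 < p.2 < 1 &
    exists2 a, powser_class a &
      powser_eval a p.1 = 0 /\ powser_eval a p.2 = 0]].

Definition diag (R : realType) : set (R * R) :=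
  [set (x, x) | x in `]-1, 1[].

Definition outliers (R : realType) : set (R * R) :=
  (@common_zeros R `\` @diag R) `\` closure (interior (@common_zeros R)).

Definition algebraic_number (R : realType) (x : R) : Prop :=
  algebraicOver (ratr : rat -> R) x.

(* Main.v *)
Require Import Defs.
From mathcomp Require Import all_boot all_order all_algebra.
From mathcomp Require Import all_classical all_reals all_analysis.
From mathcomp Require Import ring lra.

(* Let [f] in the class vanish at [g] and [l], with [|g l| < 1/2] and
   [|g| <> |l|]; a box-counting argument shows that [|x y| > 1/2] forces
   [(x, y)] to be a common zero, and [l = - g] forces [g ^ 2 >= 1/2], so no
   outlier violates these two conditions.

   Let [A] be the set of points (sum al_i x^i, sum al_i y^i) with [al_i] in
   {0, 1}.  A translate [A + e] pushed through a gap of [A] is linked with [A],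
   so any two chains with small steps joining suitable points of [A] and of
   [A + e] come close to each other.  This is stable under perturbation of
   [(x, y)] and [e].  If some [h] in the class has [|h| <= d] at [(x, y)], then
   [A] is connected by chains of step [d]; if moreover [A + e] is
   the piece given by a long prefix [b], the linked chains yield a series
   starting with [b] and at most [d / 2] at [(x, y)].  Iterating, [(x, y)] is a
   common zero.  Hence [(g, l)] is in the closure of the interior as soon as,
   arbitrarily close to it, the normalized values of long prefixes hit the
   required [e]; the two coordinates are independent, and each is settled by the
   intermediate value theorem.

   If [f] changes sign at a zero, any long prefix of [f] works there.  If [f]
   keeps a sign, one has to make the tail of the prefix extremal, which fails
   only if [f] itself is eventually extremal, hence rational, and then both zeros
   are algebraic.  If [f] keeps a sign at both zeros, they are at least
   double, and a Jensen-type bound (Blaschke factors) gives [|g l| > 1/2]. *)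

Set Implicit Arguments.
Unset Strict Implicit.
Unset Printing Implicit Defensive.

Import Order.TTheory GRing.Theory Num.Theory.
Import numFieldNormedType.Exports.

Local Open Scope classical_set_scope.
Local Open Scope ring_scope.

(** * Power series with bounded coefficients on the open unit interval *)

Section BoundedPowerSeries.
Context {R : realType}.
Implicit Types (a b : R^nat) (x y C : R).

Definition bounded_by C a := forall n, `|a n| <= C.

Definition seq_shift (n : nat) a : R^nat := fun i => a (n + i)%N.

Definition poly_trunc (n : nat) a : {poly R} := \poly_(i < n) a i.

Lemma bounded_by_shift C a n : bounded_by C a -> bounded_by C (seq_shift n a).
Proof. by move=> ha i; apply: ha. Qed.

Lemma bounded_ge0 C a : bounded_by C a -> 0 <= C.
Proof. by move=> ha; apply: le_trans (ha 0%N); apply: normr_ge0. Qed.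

Lemma cvg_normed_powser C a x : bounded_by C a -> `|x| < 1 ->
  cvgn [normed pseries a x].
Proof.
move=> ha x1; apply: (@series_le_cvg _ _ (geometric C `|x|)) => [n|n|n|] /=.
- exact: normr_ge0.
- by rewrite mulr_ge0 ?exprn_ge0 ?(bounded_ge0 ha).
- by rewrite normrM normrX ler_wpM2r ?exprn_ge0.
- by apply: is_cvg_geometric_series; rewrite normr_id.
Qed.

Lemma cvg_powser C a x : bounded_by C a -> `|x| < 1 ->
  pseries a x n @[n --> \oo] --> powser_eval a x.
Proof.
by move=> ha x1; apply: normed_cvg; apply: (cvg_normed_powser ha).
Qed.

Lemma powser_evalD C D a b x : bounded_by C a -> bounded_by D b -> `|x| < 1 ->
  powser_eval (fun i => a i + b i) x = powser_eval a x + powser_eval b x.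
Proof.
move=> ha hb x1; apply: cvg_lim => //.
have -> : pseries (fun i => a i + b i) x = pseries a x \+ pseries b x.
  apply/funext => n /=; rewrite /pseries /series /= -big_split /=.
  by apply: eq_bigr => i _; rewrite mulrDl.
by apply: cvgD; [apply: cvg_powser ha x1|apply: cvg_powser hb x1].
Qed.

Lemma powser_evalZ C k a x : bounded_by C a -> `|x| < 1 ->
  powser_eval (fun i => k * a i) x = k * powser_eval a x.
Proof.
move=> ha x1; apply: cvg_lim => //.
have -> : pseries (fun i => k * a i) x = k \o* pseries a x.
  apply/funext => n /=; rewrite /pseries /series /= mulrC mulr_sumr.
  by apply: eq_bigr => i _; rewrite mulrA.
rewrite mulrC; apply: cvgMl; exact: cvg_powser ha x1.
Qed.

Lemma powser_evalB C D a b x : bounded_by C a -> bounded_by D b -> `|x| < 1 ->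
  powser_eval (fun i => a i - b i) x = powser_eval a x - powser_eval b x.
Proof.
move=> ha hb x1; have hNb : bounded_by D (fun i => -1 * b i).
  by move=> i; rewrite mulN1r normrN.
rewrite -mulN1r -(powser_evalZ _ hb x1) -(powser_evalD ha hNb x1).
by congr powser_eval; apply/funext => i; rewrite mulN1r.
Qed.

Lemma powser_eval_shift C a x : bounded_by C a -> `|x| < 1 ->
  powser_eval a x = a 0%N + x * powser_eval (seq_shift 1 a) x.
Proof.
move=> ha x1; apply: cvg_lim => //; rewrite -cvg_shiftS /=.
have -> : (fun n => pseries a x n.+1) =
          cst (a 0%N) \+ (x \o* pseries (seq_shift 1 a) x).
  apply/funext => n /=; rewrite /pseries /series /= big_nat_recl //= expr0 mulr1.
  congr +%R; rewrite mulrC mulr_sumr; apply: eq_bigr => i _.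
  by rewrite /seq_shift add1n exprS mulrCA.
apply: cvgD; first exact: cvg_cst.
by rewrite mulrC; apply: cvgMl; apply: cvg_powser (bounded_by_shift 1 ha) x1.
Qed.

Lemma powser_eval_trunc C a x n : bounded_by C a -> `|x| < 1 ->
  powser_eval a x = (poly_trunc n a).[x] + x ^+ n * powser_eval (seq_shift n a) x.
Proof.
move=> ha x1; elim: n => [|n ->].
  rewrite /poly_trunc horner_poly big_ord0 add0r expr0 mul1r.
  by congr powser_eval; apply/funext.
rewrite (powser_eval_shift (bounded_by_shift n ha) x1) /poly_trunc !horner_poly.
rewrite big_ord_recr /= -addrA; congr +%R.
rewrite mulrDr exprSr mulrA /seq_shift addn0 [a n * _]mulrC; congr (_ + _ * _).
by congr powser_eval; apply/funext => i; rewrite addnA addn1.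
Qed.

Lemma powser_eval_bound C a x : bounded_by C a -> `|x| < 1 ->
  `|powser_eval a x| <= C / (1 - `|x|).
Proof.
move=> ha x1; have nx : `| `|x| | < 1 by rewrite normr_id.
apply: (le_trans (lim_series_norm (cvg_normed_powser ha x1))).
rewrite -(cvg_lim _ (@cvg_geometric_series _ C _ nx))//.
apply: lim_series_le; first exact: cvg_normed_powser ha x1.
  exact: is_cvg_geometric_series.
by move=> n /=; rewrite normrM normrX ler_wpM2r ?exprn_ge0.
Qed.

(* Long division of the series by [X - x]. *)
Lemma powser_eval_div C a x y : bounded_by C a -> `|x| < 1 -> `|y| < 1 ->
  powser_eval a y = powser_eval a x
    + (y - x) * powser_eval (fun n => powser_eval (seq_shift n.+1 a) x) y.
Proof.
move=> ha x1 y1; set h := (fun n => _).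
have hb : bounded_by (C / (1 - `|x|)) h.
  by move=> n; apply: powser_eval_bound => //; apply: bounded_by_shift.
pose D := C / (1 - `|x|).
pose g n := powser_eval (seq_shift n a) x.
have gb : bounded_by D g.
  by move=> n; apply: powser_eval_bound => //; apply: bounded_by_shift.
have xhb : bounded_by D (fun i => x * h i).
  move=> i; rewrite normrM; apply: le_trans (hb i).
  by apply: ler_piMl => //; apply: ltW.
have -> : powser_eval a y = powser_eval (fun i => g i - x * h i) y.
  congr powser_eval; apply/funext => n; rewrite /g /h.
  rewrite (powser_eval_shift (bounded_by_shift n ha) x1) /seq_shift addn0.
  set u := powser_eval _ _; set v := powser_eval _ _.
  suff -> : u = v by ring.
  by congr powser_eval; apply/funext => i; rewrite addnA addn1.
rewrite (powser_evalB gb xhb y1) (powser_evalZ _ hb y1).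
rewrite (powser_eval_shift gb y1).
have -> : g 0%N = powser_eval a x by congr powser_eval; apply/funext.
have -> : seq_shift 1 g = h by [].
by ring.
Qed.

(** The quotient in the division by [X - x] again has bounded coefficients, with bound
    [C / (1 - |x|)], so its value at [y] is controlled by the geometric bound. *)
Lemma powser_eval_lipschitz C a x y : bounded_by C a -> `|x| < 1 -> `|y| < 1 ->
  `|powser_eval a y - powser_eval a x|
    <= `|y - x| * (C / ((1 - `|x|) * (1 - `|y|))).
Proof.
move=> ha x1 y1; rewrite (powser_eval_div ha x1 y1) addrAC subrr add0r normrM.
apply: ler_wpM2l => //; rewrite invfM mulrA; apply: powser_eval_bound => //.
by move=> n; apply: powser_eval_bound => //; apply: bounded_by_shift.
Qed.

(** The radius depends on the coefficient bound only, so that later one neighbourhood serves all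
    binary expansions at once. *)
Lemma powser_eval_unif_cont C x (e : R) : `|x| < 1 -> 0 < e ->
  exists2 d, 0 < d & forall y, `|y - x| < d -> `|y| < 1 /\
    forall a, bounded_by C a -> `|powser_eval a y - powser_eval a x| < e.
Proof.
move=> x1 e0; set r := 1 - `|x|; have r0 : 0 < r by rewrite subr_gt0.
(* The first bound keeps [y] at distance [r / 2] from the unit circle; the second comes from the
   Lipschitz constant there. [|C| + 1] stands in for [C], whose sign is known only once a series is
   given. *)
pose d := Num.min (r / 2) (e * r ^+ 2 / (2 * (`|C| + 1))).
have C1 : 0 < `|C| + 1 by rewrite ltr_wpDl.
exists d.
  by rewrite lt_min divr_gt0 //= divr_gt0 ?mulr_gt0 ?exprn_gt0.
move=> y; rewrite lt_min => /andP[yx1 yx2].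
have ny : `|y| <= `|x| + `|y - x|.
  by rewrite -{1}(subrK x y) addrC ler_normD.
have ry : r / 2 <= 1 - `|y| by rewrite /r in yx1 *; lra.
have y1 : `|y| < 1 by lra.
split => // a ha; apply: le_lt_trans (powser_eval_lipschitz ha x1 y1) _.
have C0 := bounded_ge0 ha.
have r2 : 0 < r ^+ 2 / 2 by rewrite divr_gt0 ?exprn_gt0.
have: C / (r * (1 - `|y|)) <= (`|C| + 1) / (r ^+ 2 / 2).
  rewrite ler_pM //; first by rewrite invr_ge0 mulr_ge0 //; lra.
    by rewrite ger0_norm //; lra.
  rewrite lef_pV2 ?posrE //; first by nra.
  by rewrite mulr_gt0 //; lra.
move=> /(ler_wpM2l (normr_ge0 (y - x)))/le_lt_trans; apply.
have -> : e = e * r ^+ 2 / (2 * (`|C| + 1)) * ((`|C| + 1) / (r ^+ 2 / 2)).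
  by field; rewrite !lt0r_neq0.
by rewrite ltr_pM2r // divr_gt0.
Qed.

Lemma cvg_series_term_le (t : R^nat) (l : R) (k : nat) :
  (forall i, 0 <= t i) -> series t n @[n --> \oo] --> l -> t k <= l.
Proof.
move=> t0 tl; have <- := cvg_lim (@Rhausdorff R) tl.
have nd : {homo series t : n m / (n <= m)%N >-> n <= m}.
  by apply/nondecreasing_seqP => n; rewrite /series /= big_nat_recr //= lerDl.
have cv : cvgn (series t) by apply/cvg_ex; exists l.
apply: le_trans (nondecreasing_cvgn_le nd cv k.+1).
by rewrite /series /= big_nat_recr //= lerDr sumr_ge0.
Qed.

Lemma powser_term_le C a x k : bounded_by C a -> `|x| < 1 ->
  (forall i, 0 <= a i * x ^+ i) -> a k * x ^+ k <= powser_eval a x.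
Proof.
move=> ha x1 p; apply: (@cvg_series_term_le (fun i => a i * x ^+ i)) => //.
exact: cvg_powser ha x1.
Qed.

Lemma powser_diff_term_le C a x y k : bounded_by C a -> `|x| < 1 -> `|y| < 1 ->
  (forall i, 0 <= a i * (x ^+ i - y ^+ i)) ->
  a k * (x ^+ k - y ^+ k) <= powser_eval a x - powser_eval a y.
Proof.
move=> ha x1 y1 p.
apply: (@cvg_series_term_le (fun i => a i * (x ^+ i - y ^+ i))) => //.
have -> : series (fun i => a i * (x ^+ i - y ^+ i)) = pseries a x \- pseries a y.
  apply/funext => n; rewrite /pseries /series /= -sumrB.
  by apply: eq_bigr => i _; rewrite mulrBr.
by apply: cvgB; [apply: cvg_powser ha x1|apply: cvg_powser ha y1].
Qed.

End BoundedPowerSeries.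

(** * Common zeros: compactness of the class, and topology of the set *)

Section CommonZeros.
Context {R : realType}.
Implicit Types (a f : R^nat) (q : R * R) (d x y : R).

Lemma expr_eventually_small (z e : R) : `|z| < 1 -> 0 < e ->
  exists n0, forall n, (n0 <= n)%N -> `|z| ^+ n < e.
Proof.
move=> z1 e0; have nz : `| `|z| | < 1 by rewrite normr_id.
have /cvgrPdist_lt/(_ _ e0)[n0 _ h] := cvg_expr nz.
exists n0 => n /h /=.
by rewrite sub0r normrN ger0_norm // exprn_ge0.
Qed.

Lemma powser_class_digit f n : powser_class f -> f n \in [:: -1; 0; 1].
Proof.
by move=> [f0 fn]; case: n => [|n]; [rewrite f0 !inE eqxx !orbT|exact: fn].
Qed.

Lemma digit_bound x : x \in [:: -1; 0; 1] -> `|x| <= 1.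
Proof. by rewrite !inE => /or3P[]/eqP->; rewrite ?normrN ?normr1 ?normr0. Qed.

Lemma powser_class_bounded f : powser_class f -> bounded_by 1 f.
Proof. by move=> hf n; apply/digit_bound/powser_class_digit. Qed.

Definition small_at d f q :=
  `|powser_eval f q.1| <= d /\ `|powser_eval f q.2| <= d.

(** A compactness argument in the style of König's lemma: digits are chosen one by one so that every
    prefix extends to series of the class that are arbitrarily small at [q]. If all three next
    digits failed, the least of their three tolerances would contradict the extendability of the
    current prefix. *)
Lemma common_zeros_approx q : `|q.1| < 1 -> `|q.2| < 1 ->
  (forall d, 0 < d -> exists2 f, powser_class f & small_at d f q) ->
  common_zeros q.
Proof.
move=> q1 q2 approx.
pose agree (s : seq R) f := forall i, (i < size s)%N -> f i = nth 0 s i.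
pose Ext s := forall d, 0 < d ->
  exists2 f, powser_class f & agree s f /\ small_at d f q.
have step s : exists c, Ext s -> Ext (rcons s c).
  have [Es|nEs] := pselect (Ext s); last by exists 0.
  apply: contrapT => none.
  have bad c : exists2 d, 0 < d &
      forall f, powser_class f -> agree (rcons s c) f -> ~ small_at d f q.
    apply: contrapT => nb; apply: none; exists c => _ d d0.
    apply: contrapT => nf; apply: nb; exists d => // f hf af sf.
    by apply: nf; exists f.
  have [d1 d1_gt0 h1] := bad (-1); have [d2 d2_gt0 h2] := bad 0.
  have [d3 d3_gt0 h3] := bad 1.
  have d0 : 0 < Num.min d1 (Num.min d2 d3) by rewrite !lt_min d1_gt0 d2_gt0.
  have [f hf [af [sf1 sf2]]] := Es _ d0.
  have agc c : f (size s) = c -> agree (rcons s c) f.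
    move=> fc i; rewrite size_rcons ltnS leq_eqVlt nth_rcons.
    by case: ltngtP => // [si _|-> _]; [exact: af|].
  have sm e : Num.min d1 (Num.min d2 d3) <= e -> small_at e f q.
    by move=> me; split; [apply: le_trans sf1 me|apply: le_trans sf2 me].
  have := powser_class_digit (size s) hf; rewrite !inE => /or3P[]/eqP/agc ac.
  - by apply: h1 hf ac (sm _ _); rewrite ge_min lexx.
  - by apply: h2 hf ac (sm _ _); rewrite !ge_min lexx orbT.
  - by apply: h3 hf ac (sm _ _); rewrite !ge_min lexx !orbT.
have [g hg] := choice step.
pose s := fix s n := if n is m.+1 then rcons (s m) (g (s m)) else [::].
have szs n : size (s n) = n by elim: n => //= n IH; rewrite size_rcons IH.
have Es n : Ext (s n).
  elim: n => [|n IH] /=; last exact: hg.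
  by move=> d d0; have [f hf sf] := approx d d0; exists f.
pose a : R^nat := fun n => g (s n).
have sa n i : (i < n)%N -> nth 0 (s n) i = a i.
  elim: n => // n IH; rewrite ltnS leq_eqVlt /= nth_rcons szs.
  by case: ltngtP => // [/IH|-> _].
have ext n d : 0 < d -> exists2 f, powser_class f &
    (forall i, (i < n)%N -> f i = a i) /\ small_at d f q.
  move=> d0; have [f hf [af sf]] := Es n d d0; exists f => //; split=> // i ni.
  by rewrite af ?szs // sa.
have ca : powser_class a.
  split.
    by have [f [f0 _] [<-]] := ext 1%N 1 ltr01.
  move=> n n0; have [f [_ hf] [<- // _]] := ext n.+1 1 ltr01.
  exact: hf.
(* The limit series [a] is compared with a small [f] sharing its first [n0] digits: the two tails
   differ by at most [2 |x|^n0 / (1 - |x|)], and [n0] is chosen to make this at most [e / 2]. *)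
have zero x : `|x| < 1 ->
    (forall n d, 0 < d -> exists2 f, powser_class f &
      (forall i, (i < n)%N -> f i = a i) /\ `|powser_eval f x| <= d) ->
    powser_eval a x = 0.
  move=> x1 ex; apply/eqP; rewrite -normr_le0; apply/ler_addgt0Pl => e e0.
  rewrite addr0; have r0 : 0 < 1 - `|x| by rewrite subr_gt0.
  have [|n0 /(_ _ (leqnn _)) hn0] :=
    expr_eventually_small x1 (_ : 0 < e / 2 * (1 - `|x|) / 2).
    by rewrite !divr_gt0 // mulr_gt0 // divr_gt0.
  have [|f hf [fa fx]] := ex n0 (e / 2); first by rewrite divr_gt0.
  have bf := powser_class_bounded hf; have ba := powser_class_bounded ca.
  rewrite (powser_eval_trunc n0 bf x1) in fx.
  rewrite (powser_eval_trunc n0 ba x1).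
  have tr : poly_trunc n0 f = poly_trunc n0 a.
    by apply/polyP => i; rewrite !coef_poly; case: ifP => // /fa.
  rewrite tr in fx.
  set t := (poly_trunc _ _).[x] in fx *.
  set u := powser_eval _ _ in fx; set v := powser_eval _ _.
  have hu : `|u| <= (1 - `|x|)^-1.
    by rewrite -div1r; apply: powser_eval_bound => //; apply: bounded_by_shift.
  have hv : `|v| <= (1 - `|x|)^-1.
    by rewrite -div1r; apply: powser_eval_bound => //; apply: bounded_by_shift.
  have -> : t + x ^+ n0 * v = (t + x ^+ n0 * u) + x ^+ n0 * (v - u) by ring.
  apply: le_trans (ler_normD _ _) _.
  suff: `|x ^+ n0 * (v - u)| <= e / 2 by move: fx; lra.
  rewrite normrM normrX.
  have uv : `|v - u| <= 2 * (1 - `|x|)^-1.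
    by apply: le_trans (ler_normB _ _) _; lra.
  have -> : e / 2 = (e / 2 * (1 - `|x|) / 2) * (2 * (1 - `|x|)^-1).
    by field; rewrite lt0r_neq0.
  by apply: ler_pM => //; exact: ltW.
split; rewrite -?ltr_norml //; exists a => //; split; apply: zero => // n d d0.
  by have [f hf [fa [f1 _]]] := ext n d d0; exists f.
by have [f hf [fa [_ f2]]] := ext n d d0; exists f.
Qed.

Lemma common_zeros_interior q : (exists2 d, 0 < d &
    forall q', `|q'.1 - q.1| < d -> `|q'.2 - q.2| < d -> common_zeros q') ->
  interior (@common_zeros R) q.
Proof.
move=> [d d0 h]; apply/nbhs_ballP; exists d => // q' [].
rewrite /= /ball /= => h1 h2; apply: h; rewrite distrC //.
Qed.

Lemma common_zeros_closure q :
  (forall d, 0 < d -> exists2 q', interior (@common_zeros R) q' &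
    `|q'.1 - q.1| < d /\ `|q'.2 - q.2| < d) ->
  closure (interior (@common_zeros R)) q.
Proof.
move=> h B /nbhs_ballP[d /= d0 dB]; have [q' iq' [h1 h2]] := h d d0.
exists q'; split => //; apply: dB; split; rewrite /ball /= distrC //.
Qed.

End CommonZeros.

(** * Binary expansions and the pigeonhole argument *)

Section BinarySeries.
Context {R : realType}.
Implicit Types (al be : nat -> bool) (q : R * R) (d x y : R).

Definition binary_eval al x : R := powser_eval (fun i => (al i)%:R) x.

Lemma binary_bounded al : @bounded_by R 1 (fun i => (al i)%:R).
Proof. by move=> i; case: (al i); rewrite ?normr1 ?normr0. Qed.

Lemma binary_evalB al be x : `|x| < 1 ->
  binary_eval al x - binary_eval be x =
  powser_eval (fun i => (al i)%:R - (be i)%:R) x.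
Proof.
by move=> x1; rewrite (powser_evalB (binary_bounded al) (binary_bounded be) x1).
Qed.

Lemma binary_diff_digit al be i : (al i)%:R - (be i)%:R \in [:: -1; 0; 1 : R].
Proof.
by case: (al i) (be i) => [] []; rewrite ?subrr ?subr0 ?sub0r !inE eqxx ?orbT.
Qed.

Lemma powser_class_binary_diff al be : al 0%N -> ~~ be 0%N ->
  @powser_class R (fun i => (al i)%:R - (be i)%:R).
Proof.
move=> a0 b0; split; first by rewrite a0 (negbTE b0) subr0.
by move=> n _; apply: binary_diff_digit.
Qed.

(** When [k] is the first difference, the remaining factor is, up to sign, a series of the class. *)
Lemma binary_eval_first_diff al be k x : `|x| < 1 ->
  (forall i, (i < k)%N -> al i = be i) ->
  binary_eval al x - binary_eval be x =
  x ^+ k * powser_eval (fun i => (al (k + i)%N)%:R - (be (k + i)%N)%:R) x.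
Proof.
move=> x1 eqab; rewrite binary_evalB //.
have bd : @bounded_by R 1 (fun i => (al i)%:R - (be i)%:R).
  by move=> i; apply/digit_bound/binary_diff_digit.
rewrite (powser_eval_trunc k bd x1) /poly_trunc horner_poly big1 ?add0r //.
by move=> i _; rewrite eqab // subrr mul0r.
Qed.

Lemma binary_eval_bound al x : `|x| < 1 -> `|binary_eval al x| <= (1 - `|x|)^-1.
Proof.
move=> x1; rewrite -div1r; apply: powser_eval_bound => //.
exact: binary_bounded.
Qed.

Lemma trunc_eq_dist (u v : R) : 0 <= u -> 0 <= v ->
  Num.truncn u = Num.truncn v -> `|u - v| < 1.
Proof.
move=> u0 v0 e; have /andP[u1 u2] := truncn_itv u0.
have /andP[v1 v2] := truncn_itv v0.
by move: u1 u2; rewrite e -natr1 => u1 u2; rewrite -natr1 in v2;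
  rewrite ltr_norml; lra.
Qed.

(* Two of the [2 ^ n] binary polynomials of degree less than [n] fall in the
   same cell of a grid of mesh [d |q.1| ^ n] by [d |q.2| ^ n]. *)
Lemma common_zeros_area q : `|q.1| < 1 -> `|q.2| < 1 -> 1 / 2 < `|q.1 * q.2| ->
  common_zeros q.
Proof.
move=> q1 q2 area; apply: common_zeros_approx => // d d0.
have q10 : 0 < `|q.1|.
  by rewrite normr_gt0; apply: contraTneq area => ->; rewrite mul0r normr0; lra.
have q20 : 0 < `|q.2|.
  by rewrite normr_gt0; apply: contraTneq area => ->; rewrite mulr0 normr0; lra.
pose D x := (1 - `|x|)^-1.
have D0 x : `|x| < 1 -> 0 < D x by move=> x1; rewrite invr_gt0 subr_gt0.
pose K x := 2 * D x / d + 1.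
have K0 x : `|x| < 1 -> 0 < K x.
  by move=> x1; rewrite ltr_wpDl // divr_ge0 ?mulr_ge0 // ltW // D0.
(* There are at most [K q.1 * K q.2 / |q.1 q.2|^n = K q.1 * K q.2 * 2^n * z^n] cells. The area
   hypothesis is exactly [z < 1], so for large [n] there are fewer cells than binary words. *)
pose z := (2 * `|q.1 * q.2|)^-1.
have z1 : `|z| < 1.
  rewrite ger0_norm ?invr_ge0 ?mulr_ge0 // invf_lt1; first by lra.
  by lra.
have [|n /(_ n (leqnn n)) hn] :=
    expr_eventually_small z1 (_ : 0 < (K q.1 * K q.2)^-1).
  by rewrite invr_gt0 mulr_gt0 ?K0.
pose al (w : n.-tuple bool) i := nth false w i.
(* Adding [D x] makes the value nonnegative, where [truncn] is the floor; it sends all negative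
   numbers to 0. *)
pose u x (w : n.-tuple bool) : R := (binary_eval (al w) x + D x) / (d * `|x| ^+ n).
have den x : 0 < `|x| -> 0 < d * `|x| ^+ n by move=> x0; rewrite mulr_gt0 ?exprn_gt0.
have u0 x w : `|x| < 1 -> 0 < `|x| -> 0 <= u x w.
  move=> x1 x0; rewrite divr_ge0 //; last by rewrite ltW ?den.
  by have := binary_eval_bound (al w) x1; rewrite ler_norml /D; lra.
pose m x := Num.truncn (2 * D x / (d * `|x| ^+ n)).
have um x w : `|x| < 1 -> 0 < `|x| -> (Num.truncn (u x w) < (m x).+1)%N.
  move=> x1 x0; rewrite ltnS; apply: le_truncn; rewrite ler_pM2r ?invr_gt0 ?den //.
  by have := binary_eval_bound (al w) x1; rewrite ler_norml /D; lra.
have mK x : `|x| < 1 -> 0 < `|x| -> (m x).+1%:R <= K x / `|x| ^+ n.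
  move=> x1 x0; rewrite -natr1.
  have /truncn_itv/andP[h _] : 0 <= 2 * D x / (d * `|x| ^+ n).
    by rewrite divr_ge0 ?mulr_ge0 // ?ltW ?D0 // ?exprn_gt0.
  apply: le_trans (lerD h (lexx 1)) _.
  have -> : K x / `|x| ^+ n = 2 * D x / (d * `|x| ^+ n) + (`|x| ^+ n)^-1.
    by rewrite /K; field; rewrite expf_neq0 !lt0r_neq0.
  rewrite lerD2l.
  by rewrite -[leLHS]invr1 lef_pV2 ?posrE ?exprn_gt0 // exprn_ile1 // ltW.
pose cell w : 'I_(m q.1).+1 * 'I_(m q.2).+1 :=
  (Ordinal (um q.1 w q1 q10), Ordinal (um q.2 w q2 q20)).
have ninj : ~ injective cell.
  move=> /leq_card; rewrite card_prod !card_ord card_tuple card_bool.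
  rewrite -(ler_nat R) natrM natrX => card.
  have : 2%:R ^+ n <= K q.1 / `|q.1| ^+ n * (K q.2 / `|q.2| ^+ n).
    by apply: le_trans card _; apply: ler_pM => //; apply: mK.
  have -> : K q.1 / `|q.1| ^+ n * (K q.2 / `|q.2| ^+ n) =
            K q.1 * K q.2 * (2%:R ^+ n * z ^+ n).
    rewrite /z exprVn exprMn normrM exprMn.
    by field; rewrite !expf_neq0 ?lt0r_neq0.
  apply/negP; rewrite -ltNge mulrCA.
  rewrite -[ltRHS]mulr1 ltr_pM2l ?exprn_gt0 //.
  rewrite mulrC -ltr_pdivlMr ?mulr_gt0 ?K0 // div1r.
  by apply: le_lt_trans hn; rewrite -normrX ler_norm.
have [w [w' [ww' cc]]] : exists w w', w != w' /\ cell w = cell w'.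
  apply: contrapT => h; apply: ninj => w w' cc; apply: contrapT => /eqP ww'.
  by apply: h; exists w, w'.
have diff : exists k, al w k != al w' k.
  apply: contrapT => h; move/eqP: ww'; apply; apply/val_inj.
  apply: (@eq_from_nth _ false); first by rewrite !size_tuple.
  by move=> i _; apply: contrapT => /eqP ?; apply: h; exists i.
case: (ex_minnP diff) => k nk mink.
have kn : (k < n)%N.
  rewrite ltnNge; apply: contraNN nk => nk.
  by rewrite /al !nth_default ?size_tuple.
have eqw i : (i < k)%N -> al w i = al w' i.
  by move=> ik; apply: contraTeq ik => /mink; rewrite -leqNgt.
(* Exchanging the two words makes the leading coefficient of the difference 1 rather than -1. *)
wlog akt : w w' ww' cc nk eqw {mink diff} / al w k.
  move=> H; have [awk|nawk] := boolP (al w k); first exact: (H w w').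
  apply: (H w' w) => //; rewrite 1?eq_sym //; first by move=> i /eqw.
  by move: nk nawk; case: (al w k) (al w' k) => [] [].
have nak' : ~~ al w' k by move: nk akt; case: (al w k) (al w' k) => [] [].
exists (fun i => (al w (k + i)%N)%:R - (al w' (k + i)%N)%:R).
  by apply: (powser_class_binary_diff (al := fun i => al w (k + i)%N)
    (be := fun i => al w' (k + i)%N)); rewrite addn0.
(* Dividing the mesh [d |x|^n] by [|x|^k] leaves [d |x|^(n - k)], which is at most [d] because
   [k < n]. *)
have small x : `|x| < 1 -> 0 < `|x| -> Num.truncn (u x w) = Num.truncn (u x w') ->
    `|powser_eval (fun i => (al w (k + i)%N)%:R - (al w' (k + i)%N)%:R) x| <= d.
  move=> x1 x0 /(trunc_eq_dist (u0 x w x1 x0) (u0 x w' x1 x0)).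
  rewrite -mulrBl normrM [X in _ * X]ger0_norm ?invr_ge0 ?(ltW (den _ x0)) //.
  rewrite ltr_pdivrMr ?den // mul1r opprD addrACA subrr addr0.
  rewrite (binary_eval_first_diff x1 eqw) normrM normrX.
  have -> : `|x| ^+ n = `|x| ^+ k * `|x| ^+ (n - k).
    by rewrite -exprD subnKC // ltnW.
  rewrite mulrCA ltr_pM2l ?exprn_gt0 // => /ltW/le_trans; apply.
  by apply: ler_piMr; rewrite ?exprn_ile1 // ltW.
by split; apply: small => //; case: cc.
Qed.

End BinarySeries.

(** * Blaschke factors, and Jensen-type bounds on zeros *)

Section BlaschkeFactors.
Context {R : realType}.
Implicit Types (a b : R^nat) (r x y z B C : R).

(** A bound on the squared Hardy norm on the circle of radius [r], stated through partial sums. *)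
Definition sqsum_le r B a := forall N, \sum_(n < N) (a n * r ^+ n) ^+ 2 <= B.

(* Dividing [a] by [X - z] and multiplying by [r - (z / r) X] preserves the
   quadratic norm on the circle of radius [r]. *)
Lemma blaschke_step C r B a z : bounded_by C a -> sqsum_le r B a ->
    0 < `|z| -> `|z| < r -> r < 1 -> powser_eval a z = 0 ->
  exists b, [/\ exists D, bounded_by D b, sqsum_le r B b,
    b 0%N = - (a 0%N * r / z) &
    forall y, `|y| < 1 -> (y - z) * powser_eval b y =
                          (r - z / r * y) * powser_eval a y].
Proof.
move=> ha sq z0 zr r1 az; have z1 : `|z| < 1 by apply: lt_trans zr r1.
have r0 : 0 < r by apply: le_lt_trans zr.
have zn : z != 0 by rewrite -normr_gt0.
pose h n := powser_eval (seq_shift n.+1 a) z.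
pose D := C / (1 - `|z|).
have hb : bounded_by D h.
  by move=> n; apply: powser_eval_bound => //; apply: bounded_by_shift.
have a0 : a 0%N = - z * h 0%N.
  by move: az; rewrite (powser_eval_shift ha z1) => /eqP;
    rewrite addr_eq0 mulNr => /eqP.
have aS n : a n.+1 = h n - z * h n.+1.
  rewrite /h (powser_eval_shift (bounded_by_shift n.+1 ha) z1) /seq_shift addn0.
  suff -> : (fun i => a (n.+1 + (1 + i))%N) = (fun i => a (n.+2 + i)%N) by ring.
  by apply/funext => i; rewrite addnA addn1.
(* [h] is the quotient of [a] by [X - z] and [k] is [X] times [h], so the new series is
   [(r - (z / r) X) h]. *)
pose k n := if n is m.+1 then h m else 0.
have D0 := bounded_ge0 hb.
have kb : bounded_by D k by case=> [|n]; rewrite /k ?normr0.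
have rhb : bounded_by (r * D) (fun n => r * h n).
  by move=> n; rewrite normrM (ger0_norm (ltW r0)) ler_pM2l.
have zkb : bounded_by (`|z / r| * D) (fun n => z / r * k n).
  by move=> n; rewrite normrM ler_wpM2l.
exists (fun n => r * h n - z / r * k n); split.
- exists (r * D + `|z / r| * D) => n.
  by apply: le_trans (ler_normB _ _) _; apply: lerD.
- pose b n := r * h n - z / r * k n.
  (* The isometry at the level of partial sums: they differ by one boundary term, which is
     nonnegative and tends to 0. Since the sums for [b] increase, going far enough makes that term
     at most [e]. *)
  have key N : \sum_(n < N.+1) (b n * r ^+ n) ^+ 2 =
      \sum_(n < N.+1) (a n * r ^+ n) ^+ 2 +
      (1 - (z / r) ^+ 2) * (h N * r ^+ N.+1) ^+ 2.
    elim: N => [|N IH].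
      rewrite !big_ord_recr !big_ord0 /b /= a0.
      by field; rewrite lt0r_neq0.
    rewrite big_ord_recr IH [in RHS]big_ord_recr /= aS /b /k !exprS.
    by field; rewrite lt0r_neq0.
  move=> N; apply/ler_addgt0Pl => e e0; rewrite addrC.
  have nr : `|r| < 1 by rewrite ger0_norm // ltW.
  have [|n0 hn0] := expr_eventually_small nr (_ : 0 < e / (D ^+ 2 + 1)).
    by rewrite divr_gt0 // ltr_wpDl // sqr_ge0.
  have mono : \sum_(n < N) (b n * r ^+ n) ^+ 2 <=
              \sum_(n < (N + n0).+1) (b n * r ^+ n) ^+ 2.
    rewrite -addnS big_split_ord /= lerDl sumr_ge0 // => i _.
    exact: sqr_ge0.
  apply: (le_trans mono); rewrite key; apply: lerD; first exact: sq.
  have {}hn0 := hn0 (N + n0)%N (leq_addl _ _).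
  rewrite (ger0_norm (ltW r0)) in hn0; set p := r ^+ (N + n0) in hn0.
  have p0 : 0 <= p by rewrite exprn_ge0 // ltW.
  have p1 : r ^+ (N + n0).+1 <= p by rewrite exprS ler_piMl // ltW.
  have p2 : 0 <= r ^+ (N + n0).+1 by rewrite exprn_ge0 // ltW.
  have pl1 : p <= 1 by rewrite exprn_ile1 // ltW.
  have h2 : h (N + n0)%N ^+ 2 <= D ^+ 2.
    by rewrite -real_normK ?num_real // ler_sqr ?nnegrE.
  rewrite [(h _ * _) ^+ 2]exprMn.
  have w2 : 1 - (z / r) ^+ 2 <= 1 by rewrite gerBl sqr_ge0.
  have w0 : 0 <= 1 - (z / r) ^+ 2.
    rewrite subr_ge0 expr_div_n ler_pdivrMr ?exprn_gt0 // mul1r.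
    by rewrite -real_normK ?num_real // ler_sqr ?nnegrE // ltW.
  have q1 : h (N + n0)%N ^+ 2 * (r ^+ (N + n0).+1) ^+ 2 <= D ^+ 2 * p.
    apply: ler_pM => //; rewrite ?sqr_ge0 //; nra.
  have q2 : D ^+ 2 * p <= e.
    have := hn0; rewrite ltr_pdivlMr ?ltr_wpDl ?sqr_ge0 //.
    by have := sqr_ge0 D; nra.
  apply: le_trans q2; apply: le_trans q1.
  by rewrite ler_piMl // mulr_ge0 // sqr_ge0.
- by rewrite /k a0 mulr0 subr0; field.
- move=> y y1; rewrite (powser_evalB rhb zkb y1) (powser_evalZ _ hb y1).
  rewrite (powser_evalZ _ kb y1) (powser_eval_shift kb y1) add0r.
  have -> : seq_shift 1 k = h by [].
  have -> : powser_eval a y = (y - z) * powser_eval h y.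
    by rewrite (powser_eval_div ha z1 y1) az add0r.
  by ring.
Qed.

Definition semidefinite_at a z := exists2 e, 0 < e &
  exists s : bool, forall y, `|y| < 1 -> `|y - z| < e ->
    0 <= (-1) ^+ s * powser_eval a y.

(** A zero without sign change is at least double: if [b] did not vanish at [z], then
    [(y - z) * b y] would take both signs near [z], whereas [a] keeps its sign and [r - z / r * y]
    is nonnegative for [|y| < r]. *)
Lemma semidefinite_quotient_zero C r a b z : bounded_by C b ->
    `|z| < r -> r < 1 -> semidefinite_at a z ->
    (forall y, `|y| < 1 -> (y - z) * powser_eval b y =
                          (r - z / r * y) * powser_eval a y) ->
  powser_eval b z = 0.
Proof.
move=> hb zr r1 [e e0 [s hs]] eqb.
have z1 : `|z| < 1 by apply: lt_trans zr r1.
have r0 : 0 < r by apply: le_lt_trans zr.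
apply/eqP; apply: contraT; rewrite -normr_gt0 => v0.
have [d d0 hd] := powser_eval_unif_cont C z1 v0.
pose t := Num.min (Num.min e d) (r - `|z|) / 2.
have t0 : 0 < t by rewrite divr_gt0 // !lt_min e0 d0 subr_gt0.
have te : t < e.
  have : Num.min (Num.min e d) (r - `|z|) <= e by rewrite !ge_min lexx.
  by rewrite /t in t0 *; lra.
have td : t < d.
  have : Num.min (Num.min e d) (r - `|z|) <= d by rewrite !ge_min lexx orbT.
  by rewrite /t in t0 *; lra.
have tr : t < r - `|z|.
  have : Num.min (Num.min e d) (r - `|z|) <= r - `|z|.
    by rewrite !ge_min lexx orbT.
  by rewrite /t in t0 *; lra.
have side y : `|y - z| = t -> 0 <= (y - z) * ((-1) ^+ s * powser_eval b y) /\
    `|powser_eval b y - powser_eval b z| < `|powser_eval b z|.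
  move=> yt; have yr : `|y| < r.
    by rewrite -(subrK z y) (le_lt_trans (ler_normD _ _)) // yt; lra.
  have y1 : `|y| < 1 by lra.
  split; last by apply: (hd y _).2 => //; rewrite yt.
  rewrite mulrCA eqb // mulrCA mulr_ge0 //; last by apply: hs; rewrite // yt.
  rewrite subr_ge0 mulrAC ler_pdivrMr //.
  apply: le_trans (ler_norm _) _; rewrite normrM.
  by apply: ler_pM => //; apply: ltW.
have [|p1 p2] := side (z + t); first by rewrite addrC addKr gtr0_norm.
have [|n1 n2] := side (z - t).
  by rewrite addrC addKr normrN gtr0_norm.
move: p1 n1; rewrite (addrC z) addrK (addrC z) addrK.
rewrite mulNr oppr_ge0 pmulr_rge0 // pmulr_rle0 //.
move: p2 n2; rewrite (addrC t) (addrC (- t)).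
set u := powser_eval b z in v0 *; set p := powser_eval b _; set n := powser_eval b _.
have : 0 <= u \/ u <= 0 by apply/orP; exact: le_total.
case: s {hs side} => /=; rewrite ?expr0 ?expr1 ?mul1r ?mulN1r.
  case=> us; [rewrite (ger0_norm us)|rewrite (ler0_norm us)];
  by rewrite !ltr_norml => /andP[??] /andP[??] ? ?; move: v0;
     rewrite ?(ger0_norm us) ?(ler0_norm us); lra.
case=> us; [rewrite (ger0_norm us)|rewrite (ler0_norm us)];
by rewrite !ltr_norml => /andP[??] /andP[??] ? ?; move: v0;
   rewrite ?(ger0_norm us) ?(ler0_norm us); lra.
Qed.

Definition semidefinite_zero a z := powser_eval a z = 0 /\ semidefinite_at a z.

(** The zero is at least double, so two Blaschke factors can be removed; each multiplies the
    constant coefficient by [r / z] up to sign. The result is [a] times the square of a rational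
    function, so other zeros keep their semidefiniteness. *)
Lemma remove_semidefinite_zero C r B a z : bounded_by C a -> sqsum_le r B a ->
    0 < `|z| -> 0 < r -> r < 1 -> semidefinite_zero a z ->
  exists b, [/\ exists D, bounded_by D b, sqsum_le r B b,
    a 0%N ^+ 2 * r ^+ 4 <= b 0%N ^+ 2 * z ^+ 4 &
    forall z', z' != z -> `|z'| < 1 ->
      semidefinite_zero a z' -> semidefinite_zero b z'].
Proof.
move=> ha sq z0 r0 r1 [az sz]; have zn : z != 0 by rewrite -normr_gt0.
(* A zero outside the disc of radius [r] is left alone: the inequality already holds for [b = a]. *)
have [zr|rz] := ltP `|z| r; last first.
  exists a; split=> //; first by exists C.
  rewrite ler_wpM2l ?sqr_ge0 //.
  have -> : z ^+ 4 = `|z| ^+ 4 by rewrite -normrX ger0_norm // exprn_even_ge0.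
  by rewrite lerXn2r ?nnegrE // ltW.
have [b [[D hb] sqb b0 eqb]] := blaschke_step ha sq z0 zr r1 az.
have bz := semidefinite_quotient_zero hb zr r1 sz eqb.
have [c [[E hc] sqc c0 eqc]] := blaschke_step hb sqb z0 zr r1 bz.
exists c; split=> //; first by exists E.
  by rewrite c0 b0 le_eqVlt; apply/orP; left; apply/eqP; field.
move=> z' zz' z'1 [az' [e e0 [s hs]]].
have eqac y : `|y| < 1 -> (y - z) ^+ 2 * powser_eval c y =
                          (r - z / r * y) ^+ 2 * powser_eval a y.
  by move=> y1; rewrite expr2 -mulrA eqc // mulrCA eqb //; ring.
have pos y : y != z -> 0 < (y - z) ^+ 2.
  by move=> yz; rewrite lt0r sqrf_eq0 subr_eq0 yz sqr_ge0.
split.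
  have := eqac z' z'1; rewrite az' mulr0 => /eqP.
  by rewrite mulf_eq0 (gt_eqF (pos _ zz')) => /eqP.
(* The smaller radius excludes [z], where [(y - z) ^ 2] vanishes and the identity gives no
   information. *)
exists (Num.min e `|z' - z|); first by rewrite lt_min e0 normr_gt0 subr_eq0.
exists s => y y1; rewrite lt_min => /andP[ye yz].
have yzn : y != z by apply: contraTneq yz => ->; rewrite distrC ltxx.
rewrite -(pmulr_rge0 _ (pos y yzn)) mulrCA eqac // mulrCA mulr_ge0 ?sqr_ge0 //.
exact: hs.
Qed.

Lemma powser_class_sqsum r f : 0 < r -> r < 1 -> powser_class f ->
  sqsum_le r (1 - r ^+ 2)^-1 f.
Proof.
move=> r0 r1 hf N; have hb := powser_class_bounded hf.
have r2 : 0 < 1 - r ^+ 2 by rewrite subr_gt0 expr_lt1 // ltW.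
apply: (@le_trans _ _ (\sum_(n < N) (r ^+ 2) ^+ n)).
  apply: ler_sum => n _; rewrite exprMn -!exprM mulnC.
  apply: ler_piMl; first by rewrite exprn_ge0 // ltW.
  by rewrite -real_normK ?num_real // expr_le1.
rewrite -[leRHS]mul1r ler_pdivlMr // mulrC.
have -> : (1 - r ^+ 2) * \sum_(n < N) (r ^+ 2) ^+ n = 1 - (r ^+ 2) ^+ N.
  by rewrite -opprB mulNr -subrX1 opprB.
by rewrite gerBl exprn_ge0 // exprn_ge0 // ltW.
Qed.

Lemma powser_class_zero_neq0 f z : powser_class f -> `|z| < 1 ->
  powser_eval f z = 0 -> 0 < `|z|.
Proof.
move=> hf z1 fz; rewrite normr_gt0; apply/eqP => z0; move: fz.
have hb := powser_class_bounded hf.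
rewrite (powser_eval_shift hb z1) z0 mul0r addr0 (proj1 hf) => /eqP.
by rewrite oner_eq0.
Qed.

Lemma semidefinite_zeros_area f x y : powser_class f -> `|x| < 1 -> `|y| < 1 ->
  x != y -> semidefinite_zero f x -> semidefinite_zero f y ->
  1 / 2 < `|x * y|.
Proof.
move=> hf x1 y1 xy fx fy; have hb := powser_class_bounded hf.
(* Removing both zeros gives [r^8 <= c_0^2 (x y)^4] with [c_0^2 <= 1 / (1 - r^2)]. The value
   [9 / 10] works because [r^8 (1 - r^2) > (1 / 2)^4] there. *)
have [r [r0 r1 rE]] : exists r : R, [/\ 0 < r, r < 1 & r = 9 / 10].
  by exists (9 / 10); split => //; lra.
have sq := powser_class_sqsum r0 r1 hf.
have x0 := powser_class_zero_neq0 hf x1 (proj1 fx).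
have y0 := powser_class_zero_neq0 hf y1 (proj1 fy).
have [b [[D bb] sqb b0 tr]] := remove_semidefinite_zero hb sq x0 r0 r1 fx.
have [|c [[E cb] sqc c0 _]] :=
  remove_semidefinite_zero bb sqb y0 r0 r1 (tr y _ y1 fy); first by rewrite eq_sym.
have := sqc 1%N; rewrite big_ord1 expr0 mulr1 => c1.
rewrite (proj1 hf) expr1n mul1r in b0.
rewrite ltNge; apply/negP => small.
have s4 : (x * y) ^+ 4 <= (1 / 2) ^+ 4.
  have -> : (x * y) ^+ 4 = `|x * y| ^+ 4.
    by rewrite -normrX ger0_norm // exprn_even_ge0.
  by rewrite lerXn2r ?nnegrE //; lra.
have y4 : 0 <= y ^+ 4 by rewrite exprn_even_ge0.
have x4 : 0 <= x ^+ 4 by rewrite exprn_even_ge0.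
have e1 : r ^+ 4 * r ^+ 4 <= c 0%N ^+ 2 * (x * y) ^+ 4.
  rewrite [(x * y) ^+ 4]exprMn [leRHS]mulrCA.
  apply: le_trans _ (ler_wpM2l x4 c0).
  rewrite [leRHS]mulrA; apply: ler_wpM2r; first by rewrite exprn_ge0 ?ltW.
  by rewrite mulrC.
have e2 : c 0%N ^+ 2 * (x * y) ^+ 4 <= (1 - r ^+ 2)^-1 * (1 / 2) ^+ 4.
  by apply: ler_pM; rewrite ?sqr_ge0 // exprn_even_ge0.
have := le_trans e1 e2.
rewrite -subr_ge0 (_ : _ - _ = - ((9 / 10) ^+ 8 - 100 / 19 / 16)).
  by rewrite oppr_ge0; lra.
by rewrite rE; field.
Qed.

(** If [f] vanished identically near [z], Blaschke factors could be removed forever, each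
    multiplying the constant coefficient by [r / |z| > 1] in absolute value while the quadratic norm
    stays bounded. *)
Lemma powser_class_nonvanishing f z (e : R) : powser_class f -> `|z| < 1 ->
  powser_eval f z = 0 -> 0 < e ->
  exists y, [/\ `|y| < 1, `|y - z| < e & powser_eval f y != 0].
Proof.
move=> hf z1 fz e0; have z0 := powser_class_zero_neq0 hf z1 fz.
apply: contrapT => none.
have [r [zr r1 r0]] : exists r, [/\ `|z| < r, r < 1 & 0 < r].
  by exists ((1 + `|z|) / 2); split; lra.
pose B := (1 - r ^+ 2)^-1.
have step N : exists b, [/\ exists D, bounded_by D b, sqsum_le r B b,
    `|b 0%N| = (r / `|z|) ^+ N &
    forall y, `|y| < 1 -> `|y - z| < e -> powser_eval b y = 0].
  elim: N => [|N [b [[D bD] sqb b0 van]]].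
    exists f; split.
    - by exists 1; apply: powser_class_bounded.
    - exact: powser_class_sqsum.
    - by rewrite (proj1 hf) normr1.
    move=> y y1 ye; apply/eqP; apply: contraT => fy.
    by exfalso; apply: none; exists y.
  have bz : powser_eval b z = 0 by apply: van; rewrite // subrr normr0.
  have [c [[E cE] sqc c0 eqc]] := blaschke_step bD sqb z0 zr r1 bz.
  exists c; split => //; first by exists E.
    rewrite c0 normrN !normrM normfV b0 (ger0_norm (ltW r0)) exprSr.
    by rewrite mulrA.
  (* At [y = z] the factorization reads [0 = 0]; there the vanishing comes from [b] being trivially
     semidefinite. *)
  move=> y y1 ye; have [->|yz] := eqVneq y z.
    apply: semidefinite_quotient_zero cE zr r1 _ eqc; exists e => //.
    by exists false => y' y'1 y'e; rewrite van // mulr0.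
  have /eqP := eqc y y1; rewrite van // mulr0 mulf_eq0 subr_eq0 (negbTE yz).
  by move/eqP.
have B0 : 0 < B by rewrite invr_gt0 subr_gt0 expr_lt1 // ltW.
have q1 : `| `|z| / r | < 1.
  by rewrite ger0_norm ?divr_ge0 ?ltW // ltr_pdivrMr // mul1r.
have [|N /(_ N (leqnn N)) hN] := expr_eventually_small q1 (_ : 0 < (B + 1)^-1).
  by rewrite invr_gt0 ltr_wpDl // ltW.
have [b [_ sqb b0 _]] := step N.
have := sqb 1%N; rewrite big_ord1 expr0 mulr1 -real_normK ?num_real // b0.
rewrite ger0_norm ?divr_ge0 // in hN; last exact: ltW.
set t := (r / `|z|) ^+ N.
have tt : (`|z| / r) ^+ N = t^-1 by rewrite /t -exprVn invf_div.
have t0 : 0 < t by rewrite exprn_gt0 // divr_gt0.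
move: hN; rewrite tt ltf_pV2 ?posrE //; last by rewrite ltr_wpDl // ltW.
by move=> h1 h2; have := sqr_ge0 t; nra.
Qed.

End BlaschkeFactors.

(** * A discrete crossing theorem for two chains in the plane *)

Lemma sign_change_small (R : realType) (d s t : R) :
  `|s - t| <= d -> (s < 0) != (t < 0) -> `|s| <= d /\ `|t| <= d.
Proof.
rewrite !ler_norml => /andP[? ?].
by case: (ltP s 0); case: (ltP t 0) => // ? ? _; split; apply/andP; split; lra.
Qed.

Lemma close_small (R : realType) (d s t : R) :
  `|s - t| <= d -> `|s| <= d -> `|t| <= 2 * d.
Proof.
by rewrite !ler_norml => /andP[? ?] /andP[? ?]; apply/andP; split; lra.
Qed.

Lemma close_same_sign (R : realType) (d s t : R) :
  2 * d < `|s| -> 2 * d < `|t| -> `|s - t| <= d -> (0 < s) = (0 < t).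
Proof.
move=> hs ht st; have d0 : 0 <= d by apply: le_trans st.
apply/idP/idP => p.
  rewrite ltNge; apply/negP => t0.
  by move: hs ht st; rewrite (gtr0_norm p) (ler0_norm t0) ler_norml => ? ? /andP[? ?]; lra.
rewrite ltNge; apply/negP => s0.
by move: hs ht st; rewrite (gtr0_norm p) (ler0_norm s0) ler_norml => ? ? /andP[? ?]; lra.
Qed.

Section Crossing.
Context {R : realType} (U V : Type).
Context (fx fy : U -> V -> R) (eU : rel U) (eV : rel V) (d : R).

Context (stepU : forall u u' v, eU u u' ->
  `|fx u v - fx u' v| <= d /\ `|fy u v - fy u' v| <= d).
Context (stepV : forall u v v', eV v v' ->
  `|fx u v - fx u v'| <= d /\ `|fy u v - fy u v'| <= d).
Context (far : forall u v, `|fx u v| <= 2 * d -> 2 * d < `|fy u v|).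

Let left u v := fx u v < 0.
Let up u v := 0 < fy u v.

(* Whether the step crosses the half-line {x = 0, y > 0}. *)
Let crossU u u' v := (left u v (+) left u' v) && up u v.
Let crossV u v v' := (left u v (+) left u v') && up u v.

(** Without a change of sign of [x] among the corners nothing is crossed. Otherwise some edge brings
    all four corners into the strip [|x| <= 2 * d]; by [far] and the small steps [y] has a constant
    sign there, so either no edge counts, or all sign changes around the square count and their
    number is even. *)
Let crossing_square u u' v v' : eU u u' -> eV v v' ->
  crossU u u' v (+) crossU u u' v' = crossV u v v' (+) crossV u' v v'.
Proof.
move=> uu' vv'; have [x1 y1] := stepU v uu'; have [x2 y2] := stepU v' uu'.
have [x3 y3] := stepV u vv'; have [x4 y4] := stepV u' vv'.
have f1 := @far u v; have f2 := @far u' v; have f3 := @far u v'.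
have f4 := @far u' v'; rewrite /crossU /crossV /left /up.
set a := fx u v in x1 x2 x3 x4 f1 f2 f3 f4 *.
set b := fx u' v in x1 x2 x3 x4 f1 f2 f3 f4 *.
set c := fx u v' in x1 x2 x3 x4 f1 f2 f3 f4 *.
set e := fx u' v' in x1 x2 x3 x4 f1 f2 f3 f4 *.
set a' := fy u v in y1 y2 y3 y4 f1 f2 f3 f4 *.
set b' := fy u' v in y1 y2 y3 y4 f1 f2 f3 f4 *.
set c' := fy u v' in y1 y2 y3 y4 f1 f2 f3 f4 *.
set e' := fy u' v' in y1 y2 y3 y4 f1 f2 f3 f4 *.
clearbody a b c e a' b' c' e'.
have d0 : 0 <= d by apply: le_trans x1.
have [same|diff] := boolP [&& (a < 0) == (b < 0), (a < 0) == (c < 0) &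
                               (a < 0) == (e < 0)].
  by case/and3P: same => /eqP <- /eqP <- /eqP <-; rewrite addbb.
have small (s t : R) : `|s - t| <= d -> (s < 0) != (t < 0) -> `|s| <= d /\ `|t| <= d.
  exact: sign_change_small.
have next (s t : R) : `|s - t| <= d -> `|s| <= d -> `|t| <= 2 * d.
  exact: close_small.
have dd (s : R) : `|s| <= d -> `|s| <= 2 * d.
  by move=> sd; apply: close_small sd; rewrite subrr normr0.
have next' (s t : R) : `|s - t| <= d -> `|t| <= d -> `|s| <= 2 * d.
  by rewrite distrC; apply: next.
have : [/\ `|a| <= 2 * d, `|b| <= 2 * d, `|c| <= 2 * d & `|e| <= 2 * d].
  have [ab|ab] := eqVneq (a < 0) (b < 0); last first.
    have [ha hb] := small _ _ x1 ab.
    by split; [exact: dd|exact: dd|exact: next x3 ha|exact: next x4 hb].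
  have [ac|ac] := eqVneq (a < 0) (c < 0); last first.
    have [ha hc] := small _ _ x3 ac.
    by split; [exact: dd|exact: next x1 ha|exact: dd|exact: next x2 hc].
  have be : (b < 0) != (e < 0) by move: diff; rewrite -ab -ac !eqxx.
  have ce : (c < 0) != (e < 0) by rewrite -ac ab.
  have [hb he] := small _ _ x4 be; have [hc _] := small _ _ x2 ce.
  by split; [exact: next' x1 hb|exact: dd|exact: dd|exact: dd].
case=> /f1 ha /f2 hb /f3 hc /f4 he.
have near (s t : R) : 2 * d < `|s| -> 2 * d < `|t| -> `|s - t| <= d ->
    (0 < s) = (0 < t).
  exact: close_same_sign.
rewrite -(near _ _ ha hb y1) -(near _ _ ha hc y3).
by case: (0 < a'); rewrite ?andbF // !andbT;
  case: (a < 0); case: (b < 0); case: (c < 0); case: (e < 0).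
Qed.

Let Fixpoint rho u p v :=
  if p is u' :: p' then crossU u u' v (+) rho u' p' v else false.

(** Sum of the square identity along a row; the inner edges cancel modulo 2. *)
Let rho_step u p v v' : path eU u p -> eV v v' ->
  rho u p v (+) rho u p v' = crossV u v v' (+) crossV (last u p) v v'.
Proof.
elim: p u => [|u' p IH] u /=; first by rewrite addbb.
move=> /andP[uu' pu'] vv'; have := crossing_square uu' vv'.
have := IH _ pu' vv'.
case: (rho u' p v); case: (rho u' p v'); case: (crossU _ _ v);
  case: (crossU _ _ v'); case: (crossV u _ _); case: (crossV u' _ _);
  by case: (crossV (last u' p) _ _).
Qed.

(* The parity of crossings along the boundary of the grid spanned by the two
   chains is the sum of the parities over its squares, which vanish; three of
   its sides lie in [y > 0], and the fourth avoids the half-line while its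
   endpoints lie on different sides of it. *)
Lemma crossing_contra u0 p v0 q : path eU u0 p -> path eV v0 q ->
  (forall v, 0 < fy u0 v) -> (forall v, 0 < fy (last u0 p) v) ->
  (forall u, 0 < fy u (last v0 q)) ->
  (forall u, `|fx u v0| <= d -> fy u v0 <= 0) ->
  fx u0 v0 < 0 -> 0 <= fx (last u0 p) v0 -> False.
Proof.
move=> pp pq up0 up1 upl pocket l0 r0.
(* On the two sides swept by the ends of [p], where [y > 0], crossings are exactly the changes of
   [left]; adding these two corner terms makes the parity constant in [v]. *)
pose inv v := rho u0 p v (+) left u0 v (+) left (last u0 p) v.
have inv_step v v' : eV v v' -> inv v = inv v'.
  move=> vv'; have := rho_step pp vv'.
  rewrite /inv /crossV /up up0 up1 !andbT.
  case: (rho u0 p v); case: (rho u0 p v'); case: (left u0 v);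
    case: (left u0 v'); case: (left _ v); by case: (left _ v').
have inv_path : inv v0 = inv (last v0 q).
  elim: q v0 pq {upl pocket l0 r0} => //= v' q IH v0 /andP[v0v' pq].
  by rewrite (inv_step _ _ v0v'); exact: IH.
(* A step changing the sign of [x] has both ends in [|x| <= d], where [pocket] forces [y <= 0]. *)
have rho0 : rho u0 p v0 = false.
  elim: p u0 pp {up0 up1 l0 r0 inv inv_step inv_path} => //= u' p IH u0.
  move=> /andP[u0u' pp]; rewrite IH // addbF /crossU /left /up.
  apply/negbTE/negP => /andP[lr u0up]; have [x1 _] := stepU v0 u0u'.
  have := pocket u0; move: lr x1; rewrite !ler_norml => lr /andP[? ?] pk.
  have : -d <= fx u0 v0 <= d.
    by move: lr; case: (ltP (fx u0 v0) 0); case: (ltP (fx u' v0) 0) => //= *;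
      apply/andP; split; lra.
  by move/pk; lra.
(* Here [y > 0] throughout, so every sign change is a crossing and the sum telescopes. *)
have rho1 : rho u0 p (last v0 q) = left u0 (last v0 q) (+) left (last u0 p) (last v0 q).
  elim: (p) (u0) => [|u' p' IH] u /=; first by rewrite addbb.
  rewrite IH /crossU /up upl andbT.
  by case: (left u _); case: (left u' _); case: (left (last _ _) _).
move: inv_path; rewrite /inv rho0 rho1 {1 2}/left l0 ltNge r0 /=.
by case: (left u0 _); case: (left _ _).
Qed.

End Crossing.

Lemma crossing_chains (R : realType) (U V : Type) (fx fy : U -> V -> R)
    (eU : rel U) (eV : rel V) (d : R) u0 p v0 q :
  (forall u u' v, eU u u' ->
    `|fx u v - fx u' v| <= d /\ `|fy u v - fy u' v| <= d) ->
  (forall u v v', eV v v' ->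
    `|fx u v - fx u v'| <= d /\ `|fy u v - fy u v'| <= d) ->
  path eU u0 p -> path eV v0 q ->
  (forall v, 0 < fy u0 v) -> (forall v, 0 < fy (last u0 p) v) ->
  (forall u, 0 < fy u (last v0 q)) ->
  (forall u, `|fx u v0| <= d -> fy u v0 <= 0) ->
  fx u0 v0 < 0 -> 0 <= fx (last u0 p) v0 ->
  exists u v, `|fx u v| <= 2 * d /\ `|fy u v| <= 2 * d.
Proof.
move=> sU sV pp pq h1 h2 h3 h4 h5 h6; apply: contrapT => none.
apply: (crossing_contra sU sV _ pp pq h1 h2 h3 h4 h5 h6) => u v xs.
by rewrite ltNge; apply/negP => ys; apply: none; exists u, v.
Qed.

(** * Chains of small steps in the set of binary expansions *)

Section Chains.
Context {R : realType}.
Implicit Types (al be : nat -> bool) (q : R * R) (e x y : R).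

Definition close_at e q al be :=
  (`|binary_eval al q.1 - binary_eval be q.1| <= e) &&
  (`|binary_eval al q.2 - binary_eval be q.2| <= e).

Definition chained e q al be :=
  exists2 p, path (close_at e q) al p & last al p = be.

(** On points this is the contraction [(x, y) -> (b + q.1 x, b + q.2 y)]; the two maps, for [b = 0]
    and [b = 1], form the iterated function system whose attractor is the set of binary
    expansions. *)
Definition bcons (b : bool) al : nat -> bool :=
  fun i => if i is j.+1 then al j else b.

Lemma bcons_eta al : bcons (al 0%N) (fun i => al i.+1) = al.
Proof. by apply/funext => -[]. Qed.

Lemma binary_eval_bcons b al x : `|x| < 1 ->
  binary_eval (bcons b al) x = b%:R + x * binary_eval al x.
Proof.
move=> x1; rewrite /binary_eval.
by rewrite (powser_eval_shift (binary_bounded (bcons b al)) x1).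
Qed.

Lemma chained_trans e q al be ga :
  chained e q al be -> chained e q be ga -> chained e q al ga.
Proof.
move=> [p pp lp] [p' pp' lp']; exists (p ++ p'); last by rewrite last_cat lp.
by rewrite cat_path pp lp.
Qed.

Lemma chained_close e q al be : close_at e q al be -> chained e q al be.
Proof. by move=> h; exists [:: be]; rewrite //= h. Qed.

Lemma close_sym e q al be : close_at e q al be -> close_at e q be al.
Proof. by rewrite /close_at distrC (distrC (_ _ q.2)). Qed.

Lemma chained_bcons e e' r q b al be : `|q.1| <= r -> `|q.2| <= r -> r < 1 ->
  r * e <= e' ->
  chained e q al be -> chained e' q (bcons b al) (bcons b be).
Proof.
move=> q1 q2 r1 ee' [p pp <-]; exists (map (bcons b) p); last by rewrite last_map.
apply: (homo_path_in (P := predT) (e := close_at e q)) => //; last exact/allP.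
move=> u v _ _ /andP[h1 h2]; rewrite /close_at.
have st x : `|x| <= r -> `|binary_eval u x - binary_eval v x| <= e ->
    `|binary_eval (bcons b u) x - binary_eval (bcons b v) x| <= e'.
  move=> xr uv; have x1 : `|x| < 1 by apply: le_lt_trans xr r1.
  rewrite !binary_eval_bcons // opprD addrACA subrr add0r -mulrBr normrM.
  by apply: le_trans ee'; apply: ler_pM.
by rewrite !st.
Qed.

(* A binary pair close at its first difference propagates through the
   self-similar structure to chains between arbitrary points. *)
Lemma chained_of_close q e al0 be0 : `|q.1| < 1 -> `|q.2| < 1 -> 0 < e ->
  al0 0%N -> ~~ be0 0%N -> close_at e q al0 be0 ->
  forall al be, chained e q al be.
Proof.
move=> q1 q2 e0 a0 b0 cl.
pose r := Num.max `|q.1| `|q.2|.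
have r1 : r < 1 by rewrite gt_max q1.
have q1r : `|q.1| <= r by rewrite le_max lexx.
have q2r : `|q.2| <= r by rewrite le_max lexx orbT.
have r0 : 0 <= r by apply: le_trans q1r.
pose D := 2 / (1 - r).
(* [D] bounds the diameter of the attractor in each coordinate. At each level, chains inside the
   halves with first digit 0 and 1 are contracted by [r], and the close pair [al0], [be0] bridges
   the halves. *)
have chain k : forall al be, chained (Num.max e (r ^+ k * D)) q al be.
  elim: k => [|k IH] al be.
    apply: chained_close; rewrite /close_at expr0 mul1r.
    have bd x : `|x| <= r ->
        `|binary_eval al x - binary_eval be x| <= Num.max e D.
      move=> xr; have x1 : `|x| < 1 by apply: le_lt_trans xr r1.
      rewrite le_max; apply/orP; right.
      apply: le_trans (ler_normB _ _) _.
      have inv : (1 - `|x|)^-1 <= (1 - r)^-1.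
        by rewrite lef_pV2 ?posrE ?subr_gt0 // lerB.
      have := binary_eval_bound al x1; have := binary_eval_bound be x1.
      by rewrite /D; lra.
    by rewrite !bd.
  set M := Num.max e _.
  have same u v : u 0%N = v 0%N -> chained M q u v.
    move=> uv; rewrite -(bcons_eta u) -(bcons_eta v) uv.
    apply: (chained_bcons _ q1r q2r r1) (IH _ _).
    rewrite maxr_pMr // /M ge_max !le_max exprS -mulrA lexx orbT andbT.
    by rewrite ler_piMl // ltW.
  have clM u v : close_at e q u v -> close_at M q u v.
    by move=> /andP[h1 h2]; rewrite /close_at !le_max h1 h2.
  have step : chained M q al0 be0 by apply/chained_close/clM.
  have step' : chained M q be0 al0 by apply/chained_close/clM/close_sym.
  case Ea : (al 0%N); case Eb : (be 0%N); [by apply: same; rewrite Ea Eb| | |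
    by apply: same; rewrite Ea Eb].
    apply: (chained_trans (same al al0 _)); first by rewrite Ea a0.
    by apply: chained_trans step (same _ _ _); rewrite Eb (negbTE b0).
  apply: (chained_trans (same al be0 _)); first by rewrite Ea (negbTE b0).
  by apply: chained_trans step' (same _ _ _); rewrite Eb a0.
have D0 : 0 < D by rewrite divr_gt0 // subr_gt0.
have nr : `|r| < 1 by rewrite ger0_norm.
have [|k /(_ k (leqnn k)) hk] := expr_eventually_small nr (_ : 0 < e / D).
  by rewrite divr_gt0.
move=> al be; have := chain k al be.
rewrite (max_l (_ : r ^+ k * D <= e)) //.
by rewrite -ler_pdivlMr // -(ger0_norm r0) ltW.
Qed.

(** The indicators of the digits 1 and -1 of [f] are two binary sequences with difference [f]; they
    are close because [f] is small, and differ at index 0 because [f] starts with 1. *)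
Lemma chained_powser_class q e f : `|q.1| < 1 -> `|q.2| < 1 -> 0 < e ->
  powser_class f -> small_at e f q -> forall al be, chained e q al be.
Proof.
move=> q1 q2 e0 hf [f1 f2].
have fE : f = fun i => (f i == 1)%:R - (f i == -1)%:R.
  apply/funext => i; have := powser_class_digit i hf; rewrite !inE.
  have n11 : (-1 == 1 :> R) = false by apply/eqP; lra.
  have n10 : (0 == 1 :> R) = false by apply/eqP; lra.
  have n01 : (0 == -1 :> R) = false by apply/eqP; lra.
  case/or3P => /eqP->; rewrite ?eqxx ?n11 ?n10 ?n01 ?subr0 ?sub0r //.
  by rewrite eq_sym n11 subr0.
apply: (@chained_of_close q e (fun i => f i == 1) (fun i => f i == -1)) => //.
- by rewrite (proj1 hf).
- by rewrite (proj1 hf); apply/eqP; lra.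
- by rewrite /close_at !binary_evalB // -fE f1 f2.
Qed.

End Chains.

(** * A translate of the attractor that cannot avoid it *)

Section Trap.
Context {R : realType}.
Implicit Types (al be : nat -> bool) (q e : R * R) (x y : R).

(** Equal [k]-th powers with [k > 0] would force equal absolute values. The bound [m] is the price,
    in the height [x - y], of one wrong digit among the first [K]. *)
Lemma powers_gap (g l : R) (K : nat) : `|g| != `|l| ->
  exists2 m, 0 < m & forall k, (0 < k < K)%N -> m <= `|g ^+ k - l ^+ k|.
Proof.
move=> gl; have neq k : (0 < k)%N -> g ^+ k != l ^+ k.
  move=> k0; apply: contra gl => /eqP e.
  by rewrite -(eqrXn2 k0) // -!normrX e.
elim: K => [|K [m m0 hm]]; first by exists 1 => // k; rewrite ltn0 andbF.
have [->|K0] := posnP K; first by exists 1 => // -[|k].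
exists (Num.min m `|g ^+ K - l ^+ K|).
  by rewrite lt_min m0 normr_gt0 subr_eq0 neq.
move=> k /andP[k0]; rewrite ltnS leq_eqVlt => /orP[/eqP->|kK].
  by rewrite ge_min lexx orbT.
by rewrite ge_min hm ?k0.
Qed.

(* The attractor of binary expansions at [(g, l)] has the horizontal edge from
   [s] to [s + (1, 1)] when the height is [x - y]; a translate of it can be
   pushed down through the gap behind that edge. *)
Lemma crossing_trap (g l : R) : `|g| < 1 -> `|l| < 1 -> `|g| != `|l| ->
  exists e0 : R * R, exists2 eps, 0 < eps &
  forall q e (d : R), `|q.1| < 1 -> `|q.2| < 1 ->
    (forall al, `|binary_eval al q.1 - binary_eval al g| <= eps /\
                `|binary_eval al q.2 - binary_eval al l| <= eps) ->
    `|e.1 - e0.1| <= eps -> `|e.2 - e0.2| <= eps -> 0 < d -> d <= eps ->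
    (exists2 f, powser_class f & small_at d f q) ->
  exists al be, `|binary_eval al q.1 - binary_eval be q.1 - e.1| <= 8 * d /\
                `|binary_eval al q.2 - binary_eval be q.2 - e.2| <= 8 * d.
Proof.
move=> g1 l1 gl.
(* [top] maximizes and [low] minimizes the height [x - y] digit by digit. Digit 0 does not affect
   the height; leaving it free in [top] gives the two ends of the edge. *)
pose top b i := if i is j.+1 then l ^+ j.+1 < g ^+ j.+1 else b : bool.
pose low i := if i is j.+1 then g ^+ j.+1 < l ^+ j.+1 else false.
pose D al := binary_eval al g - binary_eval al l.
have dev (a b : nat -> bool) k :
    (forall i, 0 <= ((a i)%:R - (b i)%:R) * (g ^+ i - l ^+ i)) ->
    ((a k)%:R - (b k)%:R) * (g ^+ k - l ^+ k) <= D a - D b.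
  move=> pos; have bd : @bounded_by R 1 (fun i => (a i)%:R - (b i)%:R).
    by move=> i; apply/digit_bound/binary_diff_digit.
  apply: le_trans (powser_diff_term_le k bd g1 l1 pos) _.
  by rewrite -!binary_evalB // /D; lra.
have topP b al i : 0 <= ((top b i)%:R - (al i)%:R) * (g ^+ i - l ^+ i).
  case: i => [|i] /=; first by rewrite subrr mulr0.
  by case: ltP => h; case: (al _); rewrite /=; nra.
have lowP al i : 0 <= ((al i)%:R - (low i)%:R) * (g ^+ i - l ^+ i).
  case: i => [|i] /=; first by rewrite subrr mulr0.
  by case: ltP => h; case: (al _); rewrite /=; nra.
have Dtop b al : D al <= D (top b).
  have := @dev (top b) al 0%N (topP b al).
  by rewrite subrr mulr0 subr_ge0.
have Dlow al : D low <= D al.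
  by have := @dev al low 0%N (lowP al); rewrite subrr mulr0 subr_ge0.
have top1 x : `|x| < 1 ->
    binary_eval (top true) x = binary_eval (top false) x + 1.
  move=> x1; rewrite -(bcons_eta (top true)) -(bcons_eta (top false)).
  by rewrite !binary_eval_bcons //= add0r addrC.
have r0 : 0 < 1 - `|g| by rewrite subr_gt0.
have [|K /(_ K (leqnn K)) hK] :=
  expr_eventually_small g1 (_ : 0 < 1 / 8 * (1 - `|g|)).
  by rewrite mulr_gt0.
have [m m0 hm] := powers_gap K gl.
(* A point less than [m] below the edge has the digits of [top] at the indices from 1 to [K - 1]. By
   the choice of [K] its abscissa is then within [1 / 8] of an end of the edge, hence at least
   [1 / 2 - 1 / 8] away from the middle. *)
have pocket al : D (top true) - D al < m ->
    3 / 8 <= `|binary_eval al g - binary_eval (top true) g + 1 / 2|.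
  move=> Dm; have agree k : (0 < k < K)%N -> al k = top (al 0%N) k.
    move=> kK; have Dm' : D (top (al 0%N)) - D al < m.
      have DE : D (top (al 0%N)) = D (top true).
        case: (al 0%N) => //; rewrite /D !top1 //; lra.
      by rewrite DE.
    apply: contraTeq (le_lt_trans (dev _ _ k (topP _ al)) Dm') => ak.
    rewrite -leNgt; have := hm k kK; have := topP (al 0%N) al k.
    move: ak; case: (al k); case: (top _ k) => // _; rewrite /= ?mulr1n ?mulr0n ?subr0 ?sub0r.
      by rewrite mulN1r => h /le_trans; apply; rewrite -normrN ger0_norm.
    by rewrite mul1r => h /le_trans; apply; rewrite ger0_norm.
  have hd : `|binary_eval al g - binary_eval (top (al 0%N)) g| <= 1 / 8.
    have eqk i : (i < K)%N -> al i = top (al 0%N) i.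
      by case: i => // i iK; apply: agree.
    rewrite (binary_eval_first_diff g1 eqk) normrM normrX.
    apply: (@le_trans _ _ (1 / 8 * (1 - `|g|) * (1 / (1 - `|g|)))).
      apply: ler_pM; rewrite ?exprn_ge0 ?(ltW hK) //.
      apply: powser_eval_bound => // i.
      exact/digit_bound/binary_diff_digit.
    by rewrite mulrA mulr1 mulfK ?lt0r_neq0.
  move: hd; case: (al 0%N); rewrite ?(top1 g g1);
    set u := binary_eval al g; set v := binary_eval _ g.
    by rewrite ler_norml ler_normr => /andP[? ?]; apply/orP; left; lra.
  by rewrite ler_norml ler_normr => /andP[? ?]; apply/orP; right; lra.
(* This translation brings [top true] to the abscissa of the middle of the edge and to [m / 2] below
   it in height, inside the pocket. *)
exists (- (1 / 2), - (1 / 2) + m / 2).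
exists (Num.min (m / 16) (1 / 32)); first by rewrite lt_min divr_gt0 //=; lra.
set eps := Num.min _ _.
have epsm : eps <= m / 16 by rewrite ge_min lexx.
have eps32 : eps <= 1 / 32 by rewrite ge_min lexx orbT.
move=> q e d q1 q2 near e1 e2 d0 deps [f hf sf].
have chain := chained_powser_class q1 q2 d0 hf sf.
(* [pu] joins the two ends of the edge; [pv], once translated, leads from inside the pocket to a
   point lower than the whole attractor, so the two must meet. *)
have [pu pathu lastu] := chain (top false) (top true).
have [pv pathv lastv] := chain (top true) low.
pose fx al be := binary_eval al q.1 - binary_eval be q.1 - e.1.
pose fy al be := fx al be - (binary_eval al q.2 - binary_eval be q.2 - e.2).
have fy_near al be : D al - D be + m / 2 - 6 * eps <= fy al be <=
                     D al - D be + m / 2 + 6 * eps.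
  have [] := near al; have [] := near be; move: e1 e2; rewrite /fy /fx /D /=.
  rewrite !ler_norml => /andP[? ?] /andP[? ?] /andP[? ?] /andP[? ?].
  by move=> /andP[? ?] /andP[? ?]; apply/andP; split; lra.
have fx_near al be :
    `|fx al be - (binary_eval al g - binary_eval be g + 1 / 2)| <= 3 * eps.
  have [] := near al; have [] := near be; move: e1; rewrite /fx /=.
  rewrite !ler_norml => /andP[? ?] /andP[? ?] _ /andP[? ?] _.
  by apply/andP; split; lra.
(* As a difference of two coordinates, [fy] moves by up to [2 * d] per step; the crossing gives
   [4 * d] for [fx] and [fy], hence [8 * d] for the second coordinate. *)
have [||||||||al [be [hx hy]]] := @crossing_chains R _ _ fx fy (close_at d q) (close_at d q)
    (2 * d) (top false) pu (top true) pv _ _ pathu pathv.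
- move=> u u' v /andP[]; rewrite /fy /fx !ler_norml => /andP[? ?] /andP[? ?].
  by split; apply/andP; split; lra.
- move=> u v v' /andP[]; rewrite /fy /fx !ler_norml => /andP[? ?] /andP[? ?].
  by split; apply/andP; split; lra.
- by move=> v; have /andP[+ _] := fy_near (top false) v; have := Dtop false v; lra.
- by move=> v; rewrite lastu; have /andP[+ _] := fy_near (top true) v;
    have := Dtop true v; lra.
- by move=> u; rewrite lastv; have /andP[+ _] := fy_near u low; have := Dlow u; lra.
- move=> u small; have /andP[_] := fy_near u (top true).
  have [|Dm] := ltP (D (top true) - D u) m; last by lra.
  move/pocket; have := fx_near u (top true).
  by rewrite ler_norml ler_normr => /andP[? ?] /orP[] ?;
    move: small; rewrite ler_norml => /andP[? ?]; lra.
- have := fx_near (top false) (top true); rewrite (top1 g g1) ler_norml.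
  by move=> /andP[? ?]; lra.
- rewrite lastu; have := fx_near (top true) (top true); rewrite ler_norml.
  by move=> /andP[? ?]; lra.
exists al, be; move: hx hy; rewrite /fy /fx !ler_norml => /andP[? ?] /andP[? ?].
by split; apply/andP; split; lra.
Qed.

End Trap.

(** * Prefixes with prescribed normalized values *)

Section Perturbation.
Context {R : realType}.
Implicit Types (a b f : R^nat) (x y z c : R).

(** Its nonzero roots are the points where the series continuing the first [M] digits of [b] must
    have a tail of value [c] in order to vanish. *)
Definition target_poly b M c : {poly R} := poly_trunc M b + c *: 'X^M.

Lemma horner_target_poly b M c x :
  (target_poly b M c).[x] = (poly_trunc M b).[x] + c * x ^+ M.
Proof. by rewrite hornerD hornerZ hornerXn. Qed.

Lemma target_quotient_cont b M c z (eps : R) : 0 < eps -> z != 0 ->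
  root (target_poly b M c) z ->
  exists2 d, 0 < d & forall x, `|x - z| < d ->
    x != 0 /\ `|- (poly_trunc M b).[x] / x ^+ M - c| <= eps.
Proof.
move=> e0 z0 /rootP pz; have nz : 0 < `|z| by rewrite normr_gt0.
pose k := eps * (`|z| / 2) ^+ M.
have k0 : 0 < k by rewrite mulr_gt0 // exprn_gt0 // divr_gt0.
have := @continuous_horner R (target_poly b M c) z.
move=> /cvgrPdist_lt/(_ _ k0)/nbhs_ballP[d1 /= d10 hd1].
exists (Num.min d1 (`|z| / 2)); first by rewrite lt_min d10 divr_gt0.
move=> x; rewrite lt_min => /andP[xd1 xz].
have zx : `|z| / 2 <= `|x|.
  have := ler_normD x (z - x); rewrite [x + _]addrC subrK distrC; lra.
have x0 : 0 < `|x| by lra.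
have xn0 : x != 0 by rewrite -normr_gt0.
split => //.
have -> : - (poly_trunc M b).[x] / x ^+ M - c = - ((target_poly b M c).[x] / x ^+ M).
  by rewrite horner_target_poly; field; rewrite expf_neq0.
have xM : 0 < `|x| ^+ M by rewrite exprn_gt0.
rewrite normrN normrM normfV normrX ler_pdivrMr //.
have := hd1 x; rewrite /ball /= distrC pz sub0r normrN => /(_ xd1)/ltW/le_trans.
apply; rewrite /k ler_wpM2l ?(ltW e0) //.
by rewrite lerXn2r ?nnegrE //; lra.
Qed.

(** A series of size [d] at [q] provides the chains; the trap then yields a tail that, appended to
    the fixed prefix of [b], gives a series of size [d / 2]. The iteration starts from [f], which is
    small near its zeros. *)
Lemma trap_common_zeros f (g l : R) : powser_class f ->
    `|g| < 1 -> `|l| < 1 -> `|g| != `|l| ->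
    powser_eval f g = 0 -> powser_eval f l = 0 ->
  exists (e0 : R * R) (eps d : R) (M0 : nat), [/\ 0 < eps, 0 < d &
    forall (q : R * R) b M, powser_class b -> (M0 <= M)%N -> (0 < M)%N ->
      `|q.1 - g| < d -> `|q.2 - l| < d -> q.1 != 0 -> q.2 != 0 ->
      `|- (poly_trunc M b).[q.1] / q.1 ^+ M - e0.1| <= eps ->
      `|- (poly_trunc M b).[q.2] / q.2 ^+ M - e0.2| <= eps ->
      common_zeros q].
Proof.
move=> hf g1 l1 gl fg fl; have [e0 [eps eps0 trap]] := crossing_trap g1 l1 gl.
have [d1 d10 hd1] := powser_eval_unif_cont 1 g1 eps0.
have [d2 d20 hd2] := powser_eval_unif_cont 1 l1 eps0.
have [r [r1 gr lr]] : exists r, [/\ r < 1, `|g| < r & `|l| < r].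
  have m1 : Num.max `|g| `|l| < 1 by rewrite gt_max g1.
  have mg : `|g| <= Num.max `|g| `|l| by rewrite le_max lexx.
  have ml : `|l| <= Num.max `|g| `|l| by rewrite le_max lexx orbT.
  by exists ((1 + Num.max `|g| `|l|) / 2); split; lra.
have r0 : 0 <= r by apply: le_trans (ltW gr).
have nr : `|r| < 1 by rewrite ger0_norm.
(* The factor [x^M <= 1 / 16] turns the error [8 * d] of the trap into [d / 2]. *)
have [|M0 hM0] := expr_eventually_small nr (_ : 0 < 1 / 16); first by lra.
exists e0, eps, (Num.min (Num.min d1 d2) (Num.min (r - `|g|) (r - `|l|))), M0.
split => //; first by rewrite !lt_min d10 d20 !subr_gt0 gr lr.
move=> q b M hb M0M Mpos.
rewrite !lt_min => /andP[/andP[q1d1 _] /andP[q1g _]].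
move=> /andP[/andP[_ q2d2] /andP[_ q2l]] q10 q20 hq1 hq2.
have qr x y : `|x - y| < r - `|y| -> `|x| < r.
  by have := ler_normD (x - y) y; rewrite subrK; lra.
have q1r := qr _ _ q1g; have q2r := qr _ _ q2l.
have [q11 near1] := hd1 _ q1d1; have [q21 near2] := hd2 _ q2d2.
have bf := powser_class_bounded hf.
have improve k : exists2 h, powser_class h & small_at (eps / 2 ^+ k) h q.
  elim: k => [|k [h hh sh]].
    exists f => //; rewrite expr0 divr1; split.
      by have := near1 f bf; rewrite fg subr0 => /ltW.
    by have := near2 f bf; rewrite fl subr0 => /ltW.
  set d := eps / 2 ^+ k in sh.
  have d0 : 0 < d by rewrite divr_gt0 // exprn_gt0.
  have deps : d <= eps.
    by rewrite ler_piMr ?(ltW eps0) // invf_le1 ?exprn_gt0 // exprn_ege1 // ler1n.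
  have near al : `|binary_eval al q.1 - binary_eval al g| <= eps /\
                 `|binary_eval al q.2 - binary_eval al l| <= eps.
    by split; apply: ltW; [apply: near1|apply: near2]; apply: binary_bounded.
  have [|al [be [c1 c2]]] :=
    trap q (- (poly_trunc M b).[q.1] / q.1 ^+ M, - (poly_trunc M b).[q.2] / q.2 ^+ M)
      d q11 q21 near hq1 hq2 d0 deps; first by exists h.
  pose h' : R^nat := fun i =>
    if (i < M)%N then b i else (al (i - M)%N)%:R - (be (i - M)%N)%:R.
  have ch' : powser_class h'.
    split; first by rewrite /h' Mpos (proj1 hb).
    move=> n n0; rewrite /h'; case: ifP => _; first exact: powser_class_digit.
    exact: binary_diff_digit.
  exists h' => //.
  have val x : `|x| < 1 -> `|x| < r -> x != 0 ->
      `|binary_eval al x - binary_eval be x - - (poly_trunc M b).[x] / x ^+ M| <= 8 * d ->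
      `|powser_eval h' x| <= eps / 2 ^+ k.+1.
    move=> x1 xr xn0 hx.
    rewrite (powser_eval_trunc M (powser_class_bounded ch') x1).
    have -> : poly_trunc M h' = poly_trunc M b.
      by apply/polyP => i; rewrite !coef_poly /h'; case: (ltnP i M).
    have -> : seq_shift M h' = fun i => (al i)%:R - (be i)%:R.
      apply/funext => i; rewrite /seq_shift /h' ltnNge leq_addr /=.
      by rewrite addKn.
    rewrite -binary_evalB //.
    have -> : (poly_trunc M b).[x] + x ^+ M * (binary_eval al x - binary_eval be x) =
        x ^+ M * (binary_eval al x - binary_eval be x - - (poly_trunc M b).[x] / x ^+ M).
      by field; rewrite expf_neq0.
    rewrite normrM normrX.
    have xM : `|x| ^+ M <= 1 / 16.
      apply: le_trans (ltW (hM0 M M0M)); rewrite (ger0_norm r0).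
      by rewrite lerXn2r ?nnegrE // ltW.
    apply: (@le_trans _ _ (1 / 16 * (8 * d))).
      by apply: ler_pM.
    by rewrite le_eqVlt; apply/orP; left; apply/eqP; rewrite /d exprS; field;
      rewrite expf_neq0.
  by split; apply: val.
apply: common_zeros_approx => // d d0.
have n2 : `|1 / 2 : R| < 1 by rewrite ger0_norm; lra.
have [|k /(_ k (leqnn k)) hk] := expr_eventually_small n2 (_ : 0 < d / eps).
  by rewrite divr_gt0.
have [h hh [s1 s2]] := improve k; exists h => //.
have dk : eps / 2 ^+ k <= d.
  rewrite mulrC -ler_pdivlMr // -exprVn -[2^-1]div1r.
  by move: hk; rewrite ger0_norm ?divr_ge0 // => /ltW.
by split; [apply: le_trans s1 dk|apply: le_trans s2 dk].
Qed.

Lemma poly_ivt_between (P : {poly R}) u v : P.[u] * P.[v] <= 0 ->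
  exists2 w, root P w & forall z (d : R), `|u - z| < d -> `|v - z| < d -> `|w - z| < d.
Proof.
wlog uv : u v / u <= v.
  move=> H uv0; have [uv|vu] := leP u v; first exact: H.
  have [|w rw hw] := H v u (ltW vu); first by rewrite mulrC.
  by exists w => // z d ? ?; apply: hw.
have main Q : Q.[u] <= 0 -> 0 <= Q.[v] ->
  exists2 w, root Q w & forall z (d : R), `|u - z| < d -> `|v - z| < d -> `|w - z| < d.
  move=> Qu Qv; have [|w /andP[uw wv] rw] := @poly_ivt R Q u v uv.
    by rewrite Qu Qv.
  exists w => // z d; rewrite !ltr_norml => /andP[? ?] /andP[? ?].
  by apply/andP; split; lra.
have [Pu|Pu] := leP P.[u] 0; have [Pv|Pv] := leP 0 P.[v] => // uv0.
- exact: main.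
- have /eqP : P.[u] * P.[v] = 0 by nra.
  rewrite mulf_eq0 (lt_eqF Pv) orbF => /eqP Pu0.
  by exists u => //; apply/rootP.
- have /eqP : P.[u] * P.[v] = 0 by nra.
  rewrite mulf_eq0 (gt_eqF Pu) /= => /eqP Pv0.
  by exists v => //; apply/rootP.
have [||w rw hw] := main (- P); rewrite ?hornerN ?oppr_le0 ?oppr_ge0 ?ltW //.
by exists w => //; rewrite rootN in rw.
Qed.

(** All discrepancies occur at index [n] or later, hence are at most [K |x|^n]; this makes the
    threshold uniform in [M], [a] and [b]. *)
Lemma target_poly_approx c x (eps : R) : `|x| < 1 -> 0 < eps ->
  exists n0, forall n M a b, (n0 <= n <= M)%N -> powser_class a -> powser_class b ->
    (forall i, (i < n)%N -> b i = a i) ->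
    `|(target_poly b M c).[x] - powser_eval a x| < eps.
Proof.
move=> x1 e0; have r0 : 0 < 1 - `|x| by rewrite subr_gt0.
pose K := 3 * (1 - `|x|)^-1 + `|c|.
have i0 : 0 < (1 - `|x|)^-1 by rewrite invr_gt0.
have K0 : 0 < K by rewrite /K; have := normr_ge0 c; lra.
have [|n0 hn0] := expr_eventually_small x1 (_ : 0 < eps / K).
  by rewrite divr_gt0.
exists n0 => n M a b /andP[n0n nM] ha hb ab.
have ba := powser_class_bounded ha; have bb := powser_class_bounded hb.
have tailb s k : bounded_by 1 s -> `|powser_eval (seq_shift k s) x| <= (1 - `|x|)^-1.
  move=> bs; rewrite -div1r; apply: powser_eval_bound => //.
  exact: bounded_by_shift.
rewrite horner_target_poly.
have -> : (poly_trunc M b).[x] = powser_eval b x - x ^+ M * powser_eval (seq_shift M b) x.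
  by rewrite (powser_eval_trunc M bb x1) addrK.
rewrite (powser_eval_trunc n bb x1) (powser_eval_trunc n ba x1).
have -> : poly_trunc n b = poly_trunc n a.
  by apply/polyP => i; rewrite !coef_poly; case: ifP => // /ab.
have := tailb _ n ba; have := tailb _ n bb; have := tailb _ M bb.
set p := (poly_trunc n a).[x]; set u := powser_eval _ x; set v := powser_eval _ x.
set w := powser_eval _ x => hu hv hw.
have -> : p + x ^+ n * v - x ^+ M * u + c * x ^+ M - (p + x ^+ n * w) =
    x ^+ n * (v - w) + x ^+ M * (c - u) by ring.
apply: (@le_lt_trans _ _ (`|x| ^+ n * K)); last first.
  by rewrite -ltr_pdivlMr // hn0.
apply: le_trans (ler_normD _ _) _; rewrite !normrM !normrX.
have xnM : `|x| ^+ M <= `|x| ^+ n by apply: ler_wiXn2l => //; exact: ltW.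
have vw : `|v - w| <= 2 * (1 - `|x|)^-1 by apply: le_trans (ler_normB _ _) _; lra.
have cu : `|c - u| <= `|c| + (1 - `|x|)^-1.
  by apply: le_trans (ler_normB _ _) _; lra.
have h1 : `|x| ^+ n * `|v - w| <= `|x| ^+ n * (2 * (1 - `|x|)^-1).
  by rewrite ler_wpM2l ?exprn_ge0.
have h2 : `|x| ^+ M * `|c - u| <= `|x| ^+ n * (`|c| + (1 - `|x|)^-1).
  by apply: ler_pM.
apply: le_trans (lerD h1 h2) _; rewrite -mulrDr /K.
by rewrite le_eqVlt; apply/orP; left; apply/eqP; ring.
Qed.

Definition changes_sign a z := forall d : R, 0 < d -> exists u v,
  [/\ `|u| < 1, `|v| < 1, `|u - z| < d, `|v - z| < d &
      powser_eval a u < 0 < powser_eval a v].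

Lemma changes_signPn a z : ~ changes_sign a z -> semidefinite_at a z.
Proof.
move=> nch; apply: contrapT => nsemi; apply: nch => d d0.
apply: contrapT => none; apply: nsemi; exists d => //.
have [[u [u1 ud au]]|nneg] :=
    pselect (exists u, [/\ `|u| < 1, `|u - z| < d & powser_eval a u < 0]).
  exists true => v v1 vd; rewrite expr1 mulN1r oppr_ge0 leNgt.
  by apply/negP => av; apply: none; exists u, v; split => //; rewrite au.
exists false => v v1 vd; rewrite expr0 mul1r leNgt.
by apply/negP => av; apply: nneg; exists v.
Qed.

(** The strict signs of [a] at two points near [z] persist for the target polynomial of any [b]
    sharing a long prefix with [a]. *)
Lemma changes_sign_root a z c (d : R) : powser_class a -> changes_sign a z ->
  0 < d -> exists n0, forall n M b, (n0 <= n <= M)%N -> powser_class b ->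
    (forall i, (i < n)%N -> b i = a i) ->
    exists2 x, root (target_poly b M c) x & `|x - z| < d.
Proof.
move=> ha ch d0; have [u [v [u1 v1 ud vd /andP[au av]]]] := ch d d0.
have nau : 0 < - powser_eval a u by rewrite oppr_gt0.
have [n1 h1] := target_poly_approx c u1 nau.
have [n2 h2] := target_poly_approx c v1 av.
exists (maxn n1 n2) => n M b /andP[]; rewrite geq_max => /andP[n1n n2n] nM hb ab.
have := h1 n M a b; rewrite n1n nM => /(_ isT ha hb ab).
have := h2 n M a b; rewrite n2n nM => /(_ isT ha hb ab).
rewrite !ltr_norml => /andP[? ?] /andP[? ?].
have [|x rx hx] := @poly_ivt_between (target_poly b M c) u v; first by nra.
by exists x => //; apply: hx.
Qed.

(** Equal to 1 at 0, so that its powers are always digits 1 or -1. *)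
Definition zsign z : R := (-1) ^+ (z < 0)%R.

Lemma zsign_mul z : zsign z * z = `|z|.
Proof.
rewrite /zsign; case: ltP => h; first by rewrite expr1 mulN1r ltr0_norm.
by rewrite expr0 mul1r ger0_norm.
Qed.

Lemma zsign_digit (t u : bool) (i : nat) :
  (-1) ^+ t * ((-1) ^+ u) ^+ i \in [:: -1; 0; 1 : R].
Proof.
rewrite -exprM -[(-1) ^+ (u * i)]signr_odd -signr_addb.
by case: (_ (+) _); rewrite !inE ?expr0 ?expr1 eqxx ?orbT.
Qed.

(* If [(-1) ^+ s * a] is nonnegative around its zero [z], making the tail of
   [a] extremal moves the value at [z] to the other side. *)
Lemma semidefinite_root a z c (s : bool) (d e : R) :
    powser_class a -> `|z| < 1 -> powser_eval a z = 0 -> 0 < e ->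
    (forall y, `|y| < 1 -> `|y - z| < e -> 0 <= (-1) ^+ s * powser_eval a y) ->
    (forall n, exists2 k, (n <= k)%N & a k != (-1) ^+ (~~ s) * zsign z ^+ k) ->
    0 < d ->
  exists n0, forall n, (n0 <= n)%N -> (0 < n)%N -> exists b, [/\ powser_class b,
    forall i, (i < n)%N -> b i = a i &
    exists M0, forall M, (M0 <= M)%N -> (n <= M)%N ->
      exists2 x, root (target_poly b M c) x & `|x - z| < d].
Proof.
move=> ha z1 az e0 semi next d0; have ba := powser_class_bounded ha.
have z0 := powser_class_zero_neq0 ha z1 az.
(* At this [y] the semidefinite sign is strict, hence survives in the target polynomial; the
   opposite sign will be produced at [z] itself. *)
have [|y [y1 yde ay]] := powser_class_nonvanishing ha z1 az (_ : 0 < Num.min d e).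
  by rewrite lt_min d0.
move: yde; rewrite lt_min => /andP[yd ye].
have say : 0 < (-1) ^+ s * powser_eval a y.
  by rewrite lt0r mulf_neq0 ?signr_eq0 // semi.
have [n0 hn0] := target_poly_approx c y1 say.
exists n0 => n n0n npos.
(* Every tail term [b i * z ^+ i] equals [- (-1)^s |z|^i], the extreme value opposite to the sign of
   [a]. *)
pose b : R^nat := fun i => if (i < n)%N then a i else (-1) ^+ (~~ s) * zsign z ^+ i.
have hb : powser_class b.
  split; first by rewrite /b npos (proj1 ha).
  move=> i i0; rewrite /b; case: ifP => _; first exact: powser_class_digit.
  exact: zsign_digit.
have bb := powser_class_bounded hb.
have ab i : (i < n)%N -> b i = a i by rewrite /b => ->.
exists b; split => //.
have [k nk ak] := next n.
have sN : (-1) ^+ (~~ s) = - (-1) ^+ s :> R by rewrite signrN.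
have ss : (-1) ^+ s * (-1) ^+ s = 1 :> R by rewrite -expr2 sqrr_sign.
have term i : (n <= i)%N -> (-1) ^+ s * (a i - b i) * z ^+ i =
    `|z| ^+ i * (1 + (-1) ^+ s * zsign z ^+ i * a i).
  move=> ni; rewrite /b ltnNge ni /= sN -zsign_mul exprMn.
  have zz : zsign z ^+ i * zsign z ^+ i = 1.
    by rewrite -exprMn -expr2 sqrr_sign expr1n.
  transitivity ((-1) ^+ s * a i * z ^+ i +
    ((-1) ^+ s * (-1) ^+ s) * zsign z ^+ i * z ^+ i); first by ring.
  rewrite ss mulrDr mulr1 addrC mul1r; congr +%R.
  transitivity ((zsign z ^+ i * zsign z ^+ i) * ((-1) ^+ s * a i * z ^+ i)).
    by rewrite zz mul1r.
  by ring.
have digit i : (-1) ^+ s * zsign z ^+ i * a i \in [:: -1; 0; 1].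
  have := zsign_digit s (z < 0) i; have := powser_class_digit i ha.
  rewrite !inE /zsign => /or3P[]/eqP-> /or3P[]/eqP->;
  by rewrite ?mulr0 ?mul0r ?mulr1 ?mulrN1 ?opprK eqxx ?orbT.
(* All changed terms move in the same direction, and the one at [k], where [a] is not extremal,
   contributes at least [|z|^k]. *)
have vb : (-1) ^+ s * powser_eval b z <= - `|z| ^+ k.
  have bd : bounded_by 2 (fun i => (-1) ^+ s * (a i - b i)).
    move=> i; rewrite normrM normr_sign mul1r.
    by apply: le_trans (ler_normB _ _) _; have := ba i; have := bb i; lra.
  have bd' : bounded_by 2 (fun i => a i - b i).
    by move=> i; apply: le_trans (ler_normB _ _) _; have := ba i; have := bb i; lra.
  have pos i : 0 <= (-1) ^+ s * (a i - b i) * z ^+ i.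
    have [ni|/ab->] := leqP n i; last by rewrite subrr mulr0 mul0r.
    rewrite term // mulr_ge0 ?exprn_ge0 //.
    by have := digit i; rewrite !inE => /or3P[]/eqP->; lra.
  have := powser_term_le k bd z1 pos; rewrite (powser_evalZ _ bd' z1).
  rewrite (powser_evalB ba bb z1) az sub0r mulrN term // lerNr => h.
  apply: le_trans h _; rewrite lerN2 ler_peMr ?exprn_ge0 //.
  have := digit k; rewrite !inE => /or3P[]/eqP h; rewrite h; [|lra|lra].
  exfalso; move/eqP: ak; apply; rewrite sN.
  have zz : zsign z ^+ k * zsign z ^+ k = 1.
    by rewrite -exprMn -expr2 sqrr_sign expr1n.
  transitivity (((-1) ^+ s * (-1) ^+ s) * (zsign z ^+ k * zsign z ^+ k) * a k).
    by rewrite ss zz !mul1r.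
  transitivity ((-1) ^+ s * zsign z ^+ k * ((-1) ^+ s * zsign z ^+ k * a k)).
    by ring.
  by rewrite h; ring.
pose K := (1 - `|z|)^-1 + `|c|.
have i0 : 0 < (1 - `|z|)^-1 by rewrite invr_gt0 subr_gt0.
have K0 : 0 < K by rewrite /K; have := normr_ge0 c; lra.
(* Truncating at [M] and adding [c z^M] costs at most [K |z|^M], less than the gain [|z|^k]. As [k]
   depends on [n], this threshold comes after the choice of [b]. *)
have [|M0 hM0] := expr_eventually_small z1 (_ : 0 < `|z| ^+ k / K).
  by rewrite divr_gt0 // exprn_gt0.
exists M0 => M M0M nM.
have sz : (-1) ^+ s * (target_poly b M c).[z] < 0.
  rewrite horner_target_poly.
  have -> : (poly_trunc M b).[z] =
      powser_eval b z - z ^+ M * powser_eval (seq_shift M b) z.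
    by rewrite (powser_eval_trunc M bb z1) addrK.
  set u := powser_eval _ z in vb *; set w := powser_eval _ z.
  have hw : `|w| <= (1 - `|z|)^-1.
    by rewrite -div1r; apply: powser_eval_bound => //; apply: bounded_by_shift.
  have -> : (-1) ^+ s * (u - z ^+ M * w + c * z ^+ M) =
     (-1) ^+ s * u + z ^+ M * ((-1) ^+ s * (c - w)) by ring.
  have : z ^+ M * ((-1) ^+ s * (c - w)) < `|z| ^+ k.
    apply: le_lt_trans (ler_norm _) _.
    rewrite !normrM normrX normr_sign mul1r.
    apply: (@le_lt_trans _ _ (`|z| ^+ M * K)); last by rewrite -ltr_pdivlMr // hM0.
    rewrite ler_wpM2l ?exprn_ge0 //; apply: le_trans (ler_normB _ _) _.
    by rewrite /K; lra.
  by move: vb; lra.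
have sy : 0 < (-1) ^+ s * (target_poly b M c).[y].
  have := hn0 n M a b; rewrite n0n nM => /(_ isT ha hb ab).
  rewrite -(normrMsign s) mulrBr ltr_norml.
  by move=> /andP[+ _]; lra.
have [|x rx hx] := @poly_ivt_between (target_poly b M c) z y.
  have : ((-1) ^+ s * (target_poly b M c).[z]) * ((-1) ^+ s * (target_poly b M c).[y]) <= 0.
    by rewrite ltW // nmulr_rlt0.
  by rewrite mulrACA ss mul1r.
by exists x => //; apply: hx => //; rewrite subrr normr0.
Qed.

(** The tail is a geometric series of ratio [(-1)^u x]; multiplying by [1 - (-1)^u X] leaves a
    rational polynomial that vanishes at [x]. *)
Lemma eventually_alternating_algebraic a x (t u : bool) n :
    powser_class a -> `|x| < 1 -> powser_eval a x = 0 ->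
    (forall k, (n <= k)%N -> a k = (-1) ^+ t * ((-1) ^+ u) ^+ k) ->
  algebraic_number x.
Proof.
(* With [n > 0] the monomial of degree [n] does not touch the constant coefficient of [Q], which is
   then 1, so [Q] is nonzero. *)
move=> ha x1 ax; wlog n0 : n / (0 < n)%N.
  move=> H tl; apply: (H n.+1) => // k nk; apply: tl; exact: ltnW.
move=> tl; have ba := powser_class_bounded ha.
pose A i : rat := if a i == 1 then 1 else if a i == -1 then -1 else 0.
have AE i : ratr (A i) = a i.
  have := powser_class_digit i ha; rewrite !inE /A.
  case/or3P => /eqP->; last by rewrite eqxx rmorph1.
    by case: eqP => [->|_]; rewrite ?rmorph1 // eqxx rmorphN rmorph1.
  have -> : (0 == 1 :> R) = false by apply/eqP; lra.
  have -> : (0 == -1 :> R) = false by apply/eqP; lra.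
  by rewrite rmorph0.
pose Q : {poly rat} := (1 - (-1) ^+ u *: 'X) * \poly_(i < n) A i
                       + ((-1) ^+ t * ((-1) ^+ u) ^+ n) *: 'X^n.
exists Q.
  have: Q.[0] = 1.
    rewrite /Q hornerD hornerM hornerZ hornerXn expr0n gtn_eqF // mulr0 addr0.
    have -> : (1 - (-1) ^+ u *: 'X).[0] = 1 :> rat.
      by rewrite !hornerE ?mulr0 ?subr0.
    rewrite mul1r.
    rewrite horner_poly (bigD1 (Ordinal n0)) //= big1.
      by rewrite /A (proj1 ha) eqxx expr0 mulr1 addr0.
    by move=> i; rewrite -val_eqE /= -lt0n => i0; rewrite expr0n gtn_eqF // mulr0.
  by apply: contra_eqN => /eqP->; rewrite horner0 eq_sym oner_eq0.
have r1 : ratr ((-1) ^+ u) = (-1) ^+ u :> R by exact: rmorph_sign.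
have r2 : ratr ((-1) ^+ t * ((-1) ^+ u) ^+ n) = (-1) ^+ t * ((-1) ^+ u) ^+ n :> R.
  by rewrite -!exprM -!exprD; exact: rmorph_sign.
have mapQ : map_poly ratr Q = (1 - (-1) ^+ u *: 'X) * poly_trunc n a
                       + ((-1) ^+ t * ((-1) ^+ u) ^+ n) *: 'X^n :> {poly R}.
  rewrite /Q rmorphD rmorphM rmorphB rmorph1 /= !map_polyZ map_polyX map_polyXn.
  rewrite /= r1 r2.
  congr (_ * _ + _).
  by apply/polyP => i; rewrite coef_map !coef_poly; case: ifP => //= _;
    rewrite ?AE ?rmorph0.
apply/rootP; rewrite mapQ !(hornerE, hornerXn).
have bs := bounded_by_shift n ba.
have tailE : (1 - (-1) ^+ u * x) * powser_eval (seq_shift n a) x =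
    (-1) ^+ t * ((-1) ^+ u) ^+ n.
  have -> : (1 - (-1) ^+ u * x) * powser_eval (seq_shift n a) x =
     powser_eval (seq_shift n a) x - x * ((-1) ^+ u * powser_eval (seq_shift n a) x).
    by ring.
  rewrite -(powser_evalZ _ bs x1) (powser_eval_shift bs x1).
  have -> : seq_shift 1 (seq_shift n a) = fun i => (-1) ^+ u * seq_shift n a i.
    apply/funext => i; rewrite /seq_shift !tl ?leq_addr //.
    by rewrite addnCA add1n exprS mulrCA.
  by rewrite addrK /seq_shift addn0 tl.
rewrite -tailE -mulrA -mulrDr mulrC; apply/eqP; rewrite mulf_eq0; apply/orP; left.
by rewrite [_ * x ^+ n]mulrC -(powser_eval_trunc n ba x1) ax.
Qed.

(** Adding [1 / (1 - x) + 1 / (1 + x)] to [f x + f (- x) = 0] gives a series with nonnegative terms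
    and constant term 4, whence [4 <= 2 / (1 - x^2)]. *)
Lemma opposite_zeros_sqr f x : powser_class f -> `|x| < 1 ->
  powser_eval f x = 0 -> powser_eval f (- x) = 0 -> 1 / 2 <= x ^+ 2.
Proof.
move=> hf x1 fx fNx; have bf := powser_class_bounded hf.
have flip a : powser_eval (fun i => (-1) ^+ i * a i) x = powser_eval a (- x).
  congr (limn _); apply/funext => n; rewrite /pseries /series /=.
  by apply: eq_bigr => i _; rewrite [(- x) ^+ i]exprNn mulrA [a i * _]mulrC.
have bd a : bounded_by 1 a -> bounded_by 1 (fun i => (-1) ^+ i * a i).
  by move=> ba i; rewrite normrM normrX normrN normr1 expr1n mul1r.
have b1 : bounded_by 1 (fun _ => 1 : R) by move=> i; rewrite normr1.
have geo y : `|y| < 1 -> powser_eval (fun _ => 1) y = (1 - y)^-1.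
  move=> y1; have n1 : 1 - y != 0.
    by rewrite subr_eq0; apply: contraTneq y1 => <-; rewrite normr1 ltxx.
  apply: (mulfI n1); rewrite mulfV // mulrBl mul1r.
  by rewrite {1}(powser_eval_shift b1 y1) addrK.
have xN1 : `|- x| < 1 by rewrite normrN.
pose G i := (f i + (-1) ^+ i * f i) + (1 + (-1) ^+ i * 1).
have D2 a b : bounded_by 1 a -> bounded_by 1 b -> bounded_by 2 (fun i => a i + b i).
  move=> ha hb i; apply: le_trans (ler_normD _ _) _.
  by have := ha i; have := hb i; lra.
have bG1 := D2 _ _ bf (bd _ bf); have bG2 := D2 _ _ b1 (bd _ b1).
have bG : bounded_by 4 G.
  move=> i; apply: le_trans (ler_normD _ _) _.
  by have := bG1 i; have := bG2 i; lra.
have pos i : 0 <= G i * x ^+ i.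
  rewrite /G; have -> : f i + (-1) ^+ i * f i + (1 + (-1) ^+ i * 1) =
     (1 + (-1) ^+ i) * (1 + f i) by ring.
  have := bf i; rewrite ler_norml => /andP[fi _].
  rewrite -signr_odd; have [oi|ei] := boolP (odd i).
    by rewrite expr1 subrr !mul0r.
  rewrite expr0 !mulr_ge0 //; first by lra.
  by rewrite exprn_even_ge0 // orbF.
have := powser_term_le 0%N bG x1 pos.
rewrite (powser_evalD bG1 bG2 x1) (powser_evalD bf (bd _ bf) x1).
rewrite (powser_evalD b1 (bd _ b1) x1) !flip fx fNx !geo //.
rewrite /G (proj1 hf) !expr0 !mulr1 !add0r opprK.
move: x1; rewrite ltr_norml => /andP[xl xr].
have -> : (1 - x)^-1 + (1 + x)^-1 = 2 / (1 - x ^+ 2).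
  by field; apply/and3P; split; apply/eqP; nra.
by rewrite ler_pdivlMr; [nra|nra].
Qed.

End Perturbation.

(** * Outliers: excluded positions and algebraicity *)

Section Outliers.
Context {R : realType}.
Implicit Types (g l : R).

(** Stretching [g] by a factor [1 + e] makes the inequality strict; the strict inequality is an open
    condition and yields common zeros all around. *)
Lemma area_closure g l : `|g| < 1 -> `|l| < 1 -> 1 / 2 <= `|g * l| ->
  closure (interior (@common_zeros R)) (g, l).
Proof.
move=> g1 l1 area; apply: common_zeros_closure => d d0.
have g0 : 0 < `|g|.
  by rewrite normr_gt0; apply: contraTneq area => ->; rewrite mul0r normr0; lra.
have l0 : 0 < `|l|.
  by rewrite normr_gt0; apply: contraTneq area => ->; rewrite mulr0 normr0; lra.
pose e := Num.min d (1 - `|g|) / 2.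
have e0 : 0 < e by rewrite divr_gt0 // lt_min d0 subr_gt0.
have ed : e < d.
  by have : Num.min d (1 - `|g|) <= d; [rewrite ge_min lexx|rewrite /e in e0 *; lra].
have eg : e < 1 - `|g|.
  by have : Num.min d (1 - `|g|) <= 1 - `|g|;
    [rewrite ge_min lexx orbT|rewrite /e in e0 *; lra].
pose g' := g * (1 + e).
have gg' : `|g' - g| < d.
  rewrite /g' mulrDr mulr1 addrC addKr normrM (gtr0_norm e0).
  by apply: le_lt_trans ed; rewrite ler_piMl // ltW.
have g'1 : `|g'| < 1.
  rewrite /g' mulrDr mulr1 (le_lt_trans (ler_normD _ _)) // normrM (gtr0_norm e0).
  have : `|g| * e <= e by rewrite ler_piMl // ltW.
  by lra.
have area' : 1 / 2 < `|g' * l|.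
  rewrite /g' mulrAC normrM (gtr0_norm (_ : 0 < 1 + e)); last by lra.
  by nra.
exists (g', l); last by rewrite /= subrr normr0.
have cP : {for (g', l), continuous (fun q : R * R => `|q.1 * q.2|)}.
  apply: (@continuous_comp _ _ _ (fun q : R * R => q.1 * q.2) (fun x => `|x|)).
    by apply: cvgM; [apply: cvg_fst|apply: cvg_snd].
  exact: norm_continuous.
have c1 : {for (g', l), continuous (fun q : R * R => `|q.1|)}.
  apply: (@continuous_comp _ _ _ (fun q : R * R => q.1) (fun x => `|x|)).
    exact: cvg_fst.
  exact: norm_continuous.
have c2 : {for (g', l), continuous (fun q : R * R => `|q.2|)}.
  apply: (@continuous_comp _ _ _ (fun q : R * R => q.2) (fun x => `|x|)).
    exact: cvg_snd.
  exact: norm_continuous.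
rewrite /interior /=; near=> q; apply: common_zeros_area; near: q.
- exact: (cvgr_lt _ c1).
- exact: (cvgr_lt _ c2).
- exact: (cvgr_gt _ cP).
Unshelve. all: by end_near. Qed.

(** At such roots the normalized prefix values are exactly [e]; by continuity they stay in the trap
    on a neighbourhood of [(x, y)], which would thus be an interior point close to [(g, l)]. *)
Lemma interior_of_target_roots f g l : powser_class f ->
    `|g| < 1 -> `|l| < 1 -> `|g| != `|l| ->
    powser_eval f g = 0 -> powser_eval f l = 0 ->
    ~ closure (interior (@common_zeros R)) (g, l) ->
  exists (e : R * R) (d : R) (M0 : nat), 0 < d /\ forall b M x y,
    powser_class b -> (M0 <= M)%N ->
    root (target_poly b M e.1) x -> `|x - g| < d ->
    root (target_poly b M e.2) y -> `|y - l| < d -> False.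
Proof.
move=> hf g1 l1 gl fg fl ncl.
have [d1 d10 h1] : exists2 d, 0 < d & forall x y, `|x - g| < d -> `|y - l| < d ->
    ~ interior (@common_zeros R) (x, y).
  apply: contrapT => none; apply: ncl; apply: common_zeros_closure => d d0.
  apply: contrapT => nq; apply: none; exists d => // x y xg yl ixy.
  by apply: nq; exists (x, y).
have [e [eps [d2 [M0 [eps0 d20 trap]]]]] := trap_common_zeros hf g1 l1 gl fg fl.
have g0 := powser_class_zero_neq0 hf g1 fg.
have l0 := powser_class_zero_neq0 hf l1 fl.
(* The bounds [|g|] and [|l|] keep [x] and [y] away from 0, and [M0.+1] ensures [0 < M]. *)
exists e, (Num.min (Num.min d1 d2) (Num.min `|g| `|l|)), M0.+1.
split; first by rewrite !lt_min d10 d20 g0.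
move=> b M x y hb M0M rx; rewrite !lt_min => /andP[/andP[xd1 xd2] /andP[xg _]].
move=> ry /andP[/andP[yd1 yd2] /andP[_ yl]].
have x0 : x != 0 by apply: contraTneq xg => ->; rewrite sub0r normrN ltxx.
have y0 : y != 0 by apply: contraTneq yl => ->; rewrite sub0r normrN ltxx.
have [d3 d30 h3] := target_quotient_cont eps0 x0 rx.
have [d4 d40 h4] := target_quotient_cont eps0 y0 ry.
apply: (h1 x y xd1 yd1); apply: common_zeros_interior.
exists (Num.min (Num.min d3 d4) (Num.min (d2 - `|x - g|) (d2 - `|y - l|))).
  by rewrite !lt_min d30 d40 !subr_gt0 xd2 yd2.
move=> q; rewrite !lt_min /= => /andP[/andP[q13 _] /andP[q1x _]].
move=> /andP[/andP[_ q24] /andP[_ q2y]].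
have [q10 hq1] := h3 _ q13; have [q20 hq2] := h4 _ q24.
apply: (trap q b M) => //.
- exact: ltnW.
- exact: leq_ltn_trans M0M.
- by have := ler_normD (q.1 - x) (x - g); rewrite addrA subrK; lra.
- by have := ler_normD (q.2 - y) (y - l); rewrite addrA subrK; lra.
Qed.

(* A sign change leaves the tail of [b] free, so it can be spent on the other
   coordinate. *)
Lemma algebraic_of_semidefinite f g l : powser_class f ->
    `|g| < 1 -> `|l| < 1 -> powser_eval f g = 0 -> powser_eval f l = 0 ->
    semidefinite_at f g -> changes_sign f l ->
    (exists (c c' d : R) (M0 : nat), 0 < d /\ forall b M x y,
      powser_class b -> (M0 <= M)%N ->
      root (target_poly b M c) x -> `|x - g| < d ->
      root (target_poly b M c') y -> `|y - l| < d -> False) ->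
  algebraic_number g /\ algebraic_number l.
Proof.
move=> hf g1 l1 fg fl [e e0 [s semi]] ch [c [c' [d [M0 [d0 noroot]]]]].
(* Either [f] deviates from the extremal tail infinitely often, and both target polynomials get
   roots, or [f] is eventually extremal. *)
have [next|] := pselect
    (forall n, exists2 k, (n <= k)%N & f k != (-1) ^+ (~~ s) * zsign g ^+ k).
  exfalso.
  have [n1 h1] := semidefinite_root c hf g1 fg e0 semi next d0.
  have [n2 h2] := changes_sign_root c' hf ch d0.
  have [|//|b [hb fb [M1 hM1]]] := h1 (maxn n1 n2).+1.
    by rewrite leqW // leq_maxl.
  pose M := maxn (maxn M0 M1) (maxn n1 n2).+1.
  have [||x rx xg] := hM1 M.
  - by rewrite !leq_max leqnn orbT.
  - by rewrite leq_max leqnn orbT.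
  have [|y ry yl] := h2 (maxn n1 n2).+1 M b _ hb fb.
    by rewrite leqW ?leq_maxr //= leq_max leqnn orbT.
  by apply: (noroot b M x y) => //; rewrite !leq_max leqnn.
move=> /existsNP[n nk].
have tl k : (n <= k)%N -> f k = (-1) ^+ (~~ s) * zsign g ^+ k.
  by move=> nk'; apply/eqP; apply: contraT => fk; exfalso; apply: nk; exists k.
split; first exact: eventually_alternating_algebraic hf g1 fg tl.
exact: eventually_alternating_algebraic hf l1 fl tl.
Qed.

End Outliers.

Theorem corollary6p4p1 (R : realType) (gamma lambda : R)
    (Hout : outliers (gamma, lambda)) :
  algebraic_number gamma /\ algebraic_number lambda.
Proof.
case: Hout => [[[g1 l1 [f hf [fg fl]]] ndiag] ncl].
rewrite /= in g1 l1 fg fl; rewrite -!ltr_norml in g1 l1.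
have gl : gamma != lambda.
  apply/eqP => gl; apply: ndiag; exists gamma; last by rewrite -gl.
  by rewrite /= in_itv /= -ltr_norml.
have area : `|gamma * lambda| < 1 / 2.
  by rewrite ltNge; apply/negP => area; apply: ncl; apply: area_closure.
have ngl : `|gamma| != `|lambda|.
  rewrite eqr_norm2 negb_or gl /=.
  apply: contraTneq area => gE; rewrite -leNgt gE.
  rewrite mulNr normrN -expr2 ger0_norm ?sqr_ge0 //.
  by apply: (opposite_zeros_sqr hf l1 fl); rewrite -gE.
have [e [d [M0 [d0 noroot]]]] := interior_of_target_roots hf g1 l1 ngl fg fl ncl.
have [chg|/changes_signPn sg] := pselect (changes_sign f gamma);
  have [chl|/changes_signPn sl] := pselect (changes_sign f lambda).
(* With sign changes at both zeros, long prefixes of [f] itself already give the forbidden roots. *)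
- exfalso.
  have [n1 h1] := changes_sign_root e.1 hf chg d0.
  have [n2 h2] := changes_sign_root e.2 hf chl d0.
  pose M := maxn M0 (maxn n1 n2).
  have n1M : (n1 <= M)%N by rewrite !leq_max leqnn orbT.
  have n2M : (n2 <= M)%N by rewrite !leq_max leqnn !orbT.
  have [|//|//|x rx xg] := h1 M M f; first by rewrite n1M /=.
  have [|//|//|y ry yl] := h2 M M f; first by rewrite n2M /=.
  by apply: (noroot f M x y) => //; rewrite leq_max leqnn.
- suff [] : algebraic_number lambda /\ algebraic_number gamma by [].
  apply: (algebraic_of_semidefinite hf l1 g1 fl fg sl chg).
  exists e.2, e.1, d, M0; split => // b M x y hb hM rx xl ry yg.
  exact: (noroot b M y x).
- apply: (algebraic_of_semidefinite hf g1 l1 fg fl sg chl).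
  by exists e.1, e.2, d, M0.
- have := semidefinite_zeros_area hf g1 l1 gl (conj fg sg) (conj fl sl).
  by rewrite ltNge (ltW area).
Qed.
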